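(* Let $K$ be a number field, and let $(V,\psi)$, $D$, $(V_{\mathrm{DR}},\psi_{\mathrm{DR}})$ and the family of $l$-adic representations $\rho_l\colon G_K\to \mathrm{GIso}_{(V_l,\psi_l)}(\mathbb{Q}_l)$ satisfy the standing assumptions listed in the context, with arbitrary weight $n\ne 0$. Let $l$ be a prime number and let $K_0/K$ be the finite Galois extension with $\rho_l^{-1}\big((G_{l,K}^{\mathrm{alg}})^{\circ}(\mathbb{Q}_l)\big)=G_{K_0}$. Then: (a) $G_{l,K_0,1}^{\mathrm{alg}}=(G_{l,K,1}^{\mathrm{alg}})^{\circ}\cup -\mathrm{Id}_{V_l}\,(G_{l,K,1}^{\mathrm{alg}})^{\circ}$. (b) The homomorphism $i_{CC}\colon \pi_0(G_{l,K,1}^{\mathrm{alg}})\to\pi_0(G_{l,K}^{\mathrm{alg}})$ induced by the inclusion $G_{l,K,1}^{\mathrm{alg}}\subset G_{l,K}^{\mathrm{alg}}$ is an epimorphism with kernel $\{(G_{l,K,1}^{\mathrm{alg}})^{\circ},\ -\mathrm{Id}_{V_l}(G_{l,K,1}^{\mathrm{alg}})^{\circ}\}$.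
   Context: Standing setting. $K$ is a number field, $G_K=\mathrm{Gal}(\overline K/K)$. $(V,\psi)$ is a rational polarized pure Hodge structure of weight $n$, $\psi\colon V\times V\to\mathbb{Q}(-n)$. $\mathrm{GIso}_{(V,\psi)}$ is the group of $g\in\mathrm{GL}_V$ with $\psi(gv,gw)=\chi(g)\psi(v,w)$ for some $\chi(g)\in\mathbb{G}_m$ and all $v,w$; $\mathrm{Iso}_{(V,\psi)}=\ker\chi$. For each prime $l$, $V_l=V\otimes\mathbb{Q}_l$, $\psi_l=\psi\otimes\mathbb{Q}_l$ (with the analogous groups), and $\rho_l$ is a continuous representation of $G_K$ on $V_l$ for which $\psi_l\colon V_l\times V_l\to\mathbb{Q}_l(-n)$ is $G_K$-equivariant. Assumptions: (D1) $D\subseteq\mathrm{End}_{\mathbb{Q}}(V)$ is a ring whose action on $V\otimes\mathbb{C}$ preserves the Hodge decomposition. (D2) $D$ has a structure of discrete $G_K$-module, giving $\rho_e\colon G_K\to\mathrm{Aut}_{\mathbb{Q}}(D)$. De Rham data: a $K$-vector space $V_{\mathrm{DR}}$ with a nondegenerate bilinear pairing $\psi_{\mathrm{DR}}\colon V_{\mathrm{DR}}\times V_{\mathrm{DR}}\to K(-n)$, a decreasing filtration $F^iV_{\mathrm{DR}}$ with graded pieces $G^iV_{\mathrm{DR}}$, and for each embedding $\sigma\colon K\to\mathbb{C}$ an isomorphism $V\otimes_{\mathbb{Q}}\mathbb{C}\simeq V_{\mathrm{DR}}\otimes_{K,\sigma}\mathbb{C}$ compatible with the forms and with the Hodge filtrations.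 (DR1) There is a canonical embedding $D\subseteq\mathrm{End}_{\overline K}(V_{\mathrm{DR}}\otimes_K\overline K)$ compatible with these comparison isomorphisms. (DR2) The action of $D$ preserves the decomposition $V\otimes\mathbb{C}=\bigoplus_i G^iV_{\mathrm{DR}}\otimes_{K,\sigma}\mathbb{C}$. (R1) $(\rho_l)_l$ is strictly compatible in the sense of Serre and $\rho_l$ is of Hodge--Tate type at every prime of $\mathcal{O}_K$ over $l$. (R2) For each $l$ and each prime $v$ outside a finite set containing all primes over $l$, the eigenvalues of an (arithmetic) Frobenius at $v$ have complex absolute value $q_v^{-n/2}$. (R3) For each prime $\lambda\mid l$ there is a Hodge--Tate decomposition $V_l\otimes_{\mathbb{Q}_l}\mathbb{C}_l=\bigoplus_i G^iV_{\mathrm{DR}}\otimes_K\mathbb{C}_l(i-n)$, $\mathbb{C}_l=\widehat{\overline K}_\lambda$. (R4) $\rho_l(\sigma)(\beta v)=\sigma(\beta)\rho_l(\sigma)(v)$ for $\beta\in D$, $v\in V_l$, $\sigma\in G_K$, and the action of $D$ on $V_l\otimes\mathbb{C}_l$ is compatible with (R3). For a finite extension $L/K$, $G_{l,L}^{\mathrm{alg}}$ is the Zariski closure of $\rho_l(G_L)$ in $\mathrm{GIso}_{(V_l,\psi_l)}$ and $G_{l,L,1}^{\mathrm{alg}}:=G_{l,L}^{\mathrm{alg}}\cap\mathrm{Iso}_{(V_l,\psi_l)}$. $\pi_0$ is the group of connected components, $\circ$ the identity component. *)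

(* Defs.v *)
From HB Require Import structures.
From mathcomp Require Import all_boot all_order all_algebra all_field.
From mathcomp Require Import finmap.
From mathcomp Require Import boolp classical_sets functions cardinality reals.
From mathcomp Require Import topology_structure connected.
From mathcomp Require Import complex.
From mathcomp Require Import mpoly.
From mathcomp Require trigo.

Set Implicit Arguments.
Unset Strict Implicit.
Unset Printing Implicit Defensive.

Import Order.TTheory GRing.Theory Num.Theory.
Local Open Scope classical_set_scope.
Local Open Scope ring_scope.

(** Conventions: vectors are rows, an [N x N] matrix [A] acts on the left by
    [A . v = v A^T] (so that [A *m B] acts as the composite), and subspaces
    are row spaces, so that the base change of a subspace along a ring
    morphism [f] is [map_mx f].  The spaces [V], [V_l] and [V_DR] are [Q^N],
    [Q_l^N] and [K^N]. *)

Definition act (F : fieldType) (N : nat) (A : 'M[F]_N) (v : 'rV[F]_N) :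
  'rV[F]_N := v *m A^T.

Definition bil (F : fieldType) (N : nat) (Psi : 'M[F]_N) (v w : 'rV[F]_N) : F :=
  (v *m Psi *m w^T) 0 0.

(** [F^N] is the direct sum of the subspaces [H p], where [H p = 0] for
    [|p| > m]. *)
Definition internal_sum (F : fieldType) (N m : nat) (H : int -> 'M[F]_N) : Prop :=
  [/\ forall p : int, (m < `|p|)%N -> H p = 0,
      (\sum_(k < m.*2.+1) H (k%:Z - m%:Z) :=: 1%:M)%MS
    & mxdirect (\sum_(k < m.*2.+1) H (k%:Z - m%:Z))%MS].

(** [ph_comp p] is the component of type [(p, n - p)].  The target [Q(-n)] of
    the polarization is identified with [Q] by means of the basis
    [(2 pi i)^-n] of [Q(-n)] in [C]; [ph_form] is the resulting Gram matrix. *)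
Record polarized_hodge (R : realType) (N : nat) (n : int) := PolarizedHodge {
  ph_form : 'M[rat]_N;
  ph_bound : nat;
  ph_comp : int -> 'M[R[i]]_N;
  ph_sum : internal_sum ph_bound ph_comp;
  ph_conj : forall p : int,
    (map_mx Num.conj (ph_comp p) :=: ph_comp (n - p))%MS;
  ph_sym : ph_form^T = (-1) ^ n *: ph_form;
  ph_orth : forall (p p' : int) (v w : 'rV[R[i]]_N), p + p' != n ->
    (v <= ph_comp p)%MS -> (w <= ph_comp p')%MS ->
    bil (map_mx ratr ph_form) v w = 0;
  ph_pos : forall (p : int) (v : 'rV[R[i]]_N),
    (v <= ph_comp p)%MS -> v != 0 ->
    0 < 'i ^ (p - (n - p)) * bil (map_mx ratr ph_form) v (map_mx Num.conj v)
}.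

Definition hodge_fil (R : realType) (N : nat) (n : int)
    (H : polarized_hodge R N n) (p : int) : 'M[R[i]]_N :=
  (\sum_(k < (ph_bound H).*2.+1 | (p <= k%:Z - (ph_bound H)%:Z)%R)
     ph_comp H (k%:Z - (ph_bound H)%:Z))%MS.

Record nonarch_abs (R : realType) (F : fieldType) (a : F -> R) : Prop := {
  abs_ge0 : forall x, 0 <= a x;
  abs_eq0 : forall x, a x = 0 <-> x = 0;
  absM : forall x y, a (x * y) = a x * a y;
  abs_ultra : forall x y, a (x + y) <= Num.max (a x) (a y)
}.

Record is_completion (R : realType) (F C : fieldType) (a : F -> R) (b : C -> R)
    (i : {rmorphism F -> C}) : Prop := {
  compl_abs : nonarch_abs b;
  compl_isom : forall x, b (i x) = a x;
  compl_dense : forall (y : C) (e : R), 0 < e -> exists x : F, b (y - i x) < e;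
  compl_complete : forall u : nat -> C,
    (forall e : R, 0 < e -> exists M : nat, forall p q : nat,
       (M <= p)%N -> (M <= q)%N -> b (u p - u q) < e) ->
    exists y : C, forall e : R, 0 < e -> exists M : nat, forall p : nat,
       (M <= p)%N -> b (u p - y) < e
}.

Record primenat := PrimeNat { pnat :> nat; pnatP : prime pnat }.

Definition padic_abs (R : realType) (l : nat) (x : rat) : R :=
  if x == 0 then 0 else
  l%:R ^ ((logn l `|denq x|)%:Z - (logn l `|numq x|)%:Z).

(** A model of the field [Q_l]; any two are uniquely isomorphic. *)
Record padicField (R : realType) (l : primenat) := PadicField {
  Qp_field :> fieldType;
  Qp_abs : Qp_field -> R;
  Qp_emb : {rmorphism rat -> Qp_field};
  Qp_completion : is_completion (padic_abs R l) Qp_abs Qp_emb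
}.

Record algClosure (F : fieldType) := AlgClosure {
  ac_field :> closedFieldType;
  ac_emb : {rmorphism F -> ac_field};
  ac_alg : forall x : ac_field, algebraicOver ac_emb x
}.

Section Galois.
Variables (K : fieldType) (Kbar : algClosure K).

Record absgal := AbsGal {
  gal_fun :> {rmorphism Kbar -> Kbar};
  gal_bij : bijective gal_fun;
  gal_fix : forall x : K, gal_fun (ac_emb Kbar x) = ac_emb Kbar x
}.

Definition gal1 : absgal.
Proof.
exists (idfun : {rmorphism Kbar -> Kbar}); last by [].
by exists idfun.
Defined.

Definition galM (g h : absgal) : absgal.
Proof.
exists ((g \o h) : {rmorphism Kbar -> Kbar}).
  exact: bij_comp (gal_bij g) (gal_bij h).
by move=> x /=; rewrite !gal_fix.
Defined.

(** [G_L], for [L] embedded in the algebraic closure by [j]. *)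
Definition gal_over (L : fieldType) (j : {rmorphism L -> Kbar}) : set absgal :=
  [set g | forall x : L, g (j x) = j x].

(** [g] and [h] are equal on the finite set [s]: the sets of such [h] form a
    basis of neighbourhoods of [g] for the Krull topology. *)
Definition gal_eq_on (s : seq Kbar) (g h : absgal) : Prop :=
  forall x : Kbar, x \in s -> g x = h x.

End Galois.

Record padic_rep (R : realType) (K : fieldType) (Kbar : algClosure K)
    (l : primenat) (Ql : padicField R l) (N : nat) := PadicRep {
  rep_mx :> absgal Kbar -> 'M[Ql]_N;
  rep1 : rep_mx (gal1 Kbar) = 1%:M;
  repM : forall g h, rep_mx (galM g h) = rep_mx g *m rep_mx h;
  rep_cont : forall (g : absgal Kbar) (e : R), 0 < e ->
    exists s : seq Kbar, forall h, gal_eq_on s g h ->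
    forall i j, Qp_abs (rep_mx h i j - rep_mx g i j) < e
}.

(** The [l]-adic cyclotomic character: the element [x] of [Z_l] such that
    [g z = z ^ a] as soon as [z ^ (l ^ m) = 1] and [a] is congruent to [x]
    modulo [l ^ m]. *)
Definition cyclo (R : realType) (K : fieldType) (Kbar : algClosure K)
    (l : primenat) (Ql : padicField R l) (g : absgal Kbar) : Ql :=
  xget 0 [set x : Ql | forall m : nat, exists2 a : nat,
    Qp_abs (x - a%:R) <= (l%:R ^+ m)^-1 &
    forall z : Kbar, z ^+ (l ^ m) = 1 -> g z = z ^+ a].

Definition integers (F : fieldType) : set F :=
  [set x | integralOver (intr : int -> F) x].
Arguments integers F : clear implicits.

(** Nonzero prime ideals of the ring of integers of an algebraic extension of
    [Q] (finite or not). *)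
Record finite_prime (F : fieldType) (P : set F) : Prop := {
  fp_sub : P `<=` integers F;
  fp_neq0 : exists2 x, P x & x != 0;
  fp_add : forall x y, P x -> P y -> P (x + y);
  fp_mul : forall a x, integers F a -> P x -> P (a * x);
  fp_proper : ~ P 1;
  fp_prime : forall a b, integers F a -> integers F b -> P (a * b) ->
    P a \/ P b
}.

(** [q_v], the number of elements of the residue field. *)
Definition prime_norm (F : fieldType) (v : set F) : nat :=
  #|` fset_set [set [set y | integers F y /\ v (y - x)] | x in integers F]|.

Section Primes.
Variables (K : fieldType) (Kbar : algClosure K).

Definition prime_over (v : set K) (P : set Kbar) : Prop :=
  finite_prime P /\ v = [set x | P (ac_emb Kbar x)].

Definition inertia (P : set Kbar) : set (absgal Kbar) :=
  [set g | forall x, integers Kbar x -> P (g x - x)].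

Definition frobenius (v : set K) : set (absgal Kbar) :=
  [set g | exists2 P, prime_over v P &
    forall x, integers Kbar x -> P (g x - x ^+ prime_norm v)].

Definition above (l : nat) (v : set K) : Prop := finite_prime v /\ v l%:R.

(** A model of [C_l], for a prime [lam] of [K] over [l]: the completion of the
    algebraic closure of [K] for an absolute value [Cl_place] inducing [lam].
    The decomposition group of [Cl_place], i.e. the Galois group of the
    completion of [K] at [lam], acts on it by continuity. *)
Record Cl_completion (R : realType) (l : primenat) (Ql : padicField R l)
    (lam : set K) := ClCompletion {
  Cl_place : Kbar -> R;
  Cl_place_abs : nonarch_abs Cl_place;
  Cl_place_rat : forall x : rat,
    Cl_place (ratr x) = padic_abs R l x;
  Cl_place_prime : lam =
    [set x | integers K x /\ Cl_place (ac_emb Kbar x) < 1];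
  Cl_field :> fieldType;
  Cl_abs : Cl_field -> R;
  Cl_emb : {rmorphism Kbar -> Cl_field};
  Cl_compl : is_completion Cl_place Cl_abs Cl_emb;
  Cl_Ql : {rmorphism Ql -> Cl_field};
  Cl_Ql_isom : forall x, Cl_abs (Cl_Ql x) = Qp_abs x;
  Cl_act : absgal Kbar -> {rmorphism Cl_field -> Cl_field};
  Cl_actE : forall g : absgal Kbar, (forall x, Cl_place (g x) = Cl_place x) ->
    (forall x, Cl_act g (Cl_emb x) = Cl_emb (g x)) /\
    (forall y, Cl_abs (Cl_act g y) = Cl_abs y)
}.

Definition Cl_decomposition (R : realType) (l : primenat) (Ql : padicField R l)
    (lam : set K) (C : Cl_completion Ql lam) : set (absgal Kbar) :=
  [set g | forall x, Cl_place C (g x) = Cl_place C x].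

Definition Cl_semilinear (R : realType) (l : primenat) (Ql : padicField R l)
    (lam : set K) (C : Cl_completion Ql lam) (N : nat)
    (rho : padic_rep Kbar Ql N) (g : absgal Kbar) (v : 'rV[C]_N) : 'rV[C]_N :=
  act (map_mx (Cl_Ql C) (rho g)) (map_mx (Cl_act C g) v).

(** [V_l (x) C_l] is isomorphic to a direct sum of Tate twists of [C_l]. *)
Definition hodge_tate (R : realType) (l : primenat) (Ql : padicField R l)
    (lam : set K) (C : Cl_completion Ql lam) (N : nat)
    (rho : padic_rep Kbar Ql N) : Prop :=
  exists (B : 'M[C]_N) (w : 'I_N -> int), B \in unitmx /\
  forall (g : absgal Kbar) (k : 'I_N), Cl_decomposition C g ->
    Cl_semilinear rho g (row k B) = Cl_Ql C (cyclo Ql g) ^ w k *: row k B.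

Definition unramified (R : realType) (l : primenat) (Ql : padicField R l)
    (N : nat) (rho : padic_rep Kbar Ql N) (v : set K) : Prop :=
  forall P g, prime_over v P -> inertia P g -> rho g = 1%:M.

End Primes.

Section Systems.
Variables (R : realType) (K : fieldType) (Kbar : algClosure K).
Variable Ql : forall l : primenat, padicField R l.
Variable N : nat.
Variable rho : forall l : primenat, padic_rep Kbar (Ql l) N.

Definition strictly_compatible : Prop :=
  exists (S : set (set K)) (P : set K -> {poly rat}), finite_set S /\
  forall v : set K, finite_prime v -> ~ S v ->
  forall l : primenat, ~ v l%:R ->
    unramified (rho l) v /\
    forall g, frobenius v g ->
      char_poly (rho l g) = map_poly (Qp_emb (Ql l)) (P v).

(** [x] is algebraic over [Q] and all its complex conjugates have absolute
    value [r]. *)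
Definition complex_abs_is (E : fieldType) (i : {rmorphism rat -> E}) (x : E)
    (r : R[i]) : Prop :=
  exists p : {poly rat}, [/\ irreducible_poly p, root (map_poly i p) x &
    forall z : R[i], root (map_poly ratr p) z -> `|z| = r].

Definition frobenius_weight (Qlbar : forall l, algClosure (Ql l)) (n : int) :
    Prop :=
  forall l : primenat, exists T : set (set K),
  [/\ finite_set T, forall v, above l v -> T v &
  forall v, finite_prime v -> ~ T v -> forall g, frobenius v g ->
  forall x : Qlbar l,
    eigenvalue (map_mx (ac_emb (Qlbar l)) (rho l g)) x ->
    complex_abs_is (ac_emb (Qlbar l) \o Qp_emb (Ql l)) x
      (sqrtC (prime_norm v)%:R ^ (- n))].

End Systems.

Definition preserves_hodge (R : realType) (N : nat) (n : int)
    (H : polarized_hodge R N n) (D : {pred 'M[rat]_N}) : Prop :=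
  {in D, forall A, forall p : int,
    (ph_comp H p *m (map_mx ratr A)^T <= ph_comp H p)%MS}.

(** Each [e g] is additive; it is also multiplicative, by
    [D_equivariant]. *)
Record discrete_module (K : fieldType) (Kbar : algClosure K) (N : nat)
    (D : {pred 'M[rat]_N}) (e : absgal Kbar -> 'M[rat]_N -> 'M[rat]_N) :
    Prop := {
  dm_closed : forall g, {in D, forall A, e g A \in D};
  dm_add : forall g, {in D &, {morph e g : A B / A + B}};
  dm1 : {in D, forall A, e (gal1 Kbar) A = A};
  dmM : forall g h, {in D, forall A, e (galM g h) A = e g (e h A)};
  dm_discrete : {in D, forall A, exists s : seq Kbar, forall g,
    gal_eq_on s (gal1 Kbar) g -> e g A = A}
}.

Definition D_equivariant (R : realType) (K : fieldType) (Kbar : algClosure K)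
    (l : primenat) (Ql : padicField R l) (N : nat) (D : {pred 'M[rat]_N})
    (e : absgal Kbar -> 'M[rat]_N -> 'M[rat]_N) (rho : padic_rep Kbar Ql N) :
    Prop :=
  {in D, forall A, forall (g : absgal Kbar) (v : 'rV[Ql]_N),
    act (rho g) (act (map_mx (Qp_emb Ql) A) v) =
    act (map_mx (Qp_emb Ql) (e g A)) (act (rho g) v)}.

Definition form_equivariant (R : realType) (K : fieldType)
    (Kbar : algClosure K) (l : primenat) (Ql : padicField R l) (N : nat)
    (n : int) (Psi : 'M[rat]_N) (rho : padic_rep Kbar Ql N) : Prop :=
  forall (g : absgal Kbar) (v w : 'rV[Ql]_N),
    bil (map_mx (Qp_emb Ql) Psi) (act (rho g) v) (act (rho g) w) =
    cyclo Ql g ^ (- n) * bil (map_mx (Qp_emb Ql) Psi) v w.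

(** [dr_fil] is the filtration [F^i V_DR] and [dr_comp s] the comparison
    isomorphism [V (x) C -> V_DR (x)_(K,s) C].  The identification of [Q(-n)]
    with [Q] fixed above accounts for the factor [(2 pi i)^-n] in
    [dr_comp_form]. *)
Record deRham (R : realType) (K : fieldType) (N : nat) (n : int)
    (H : polarized_hodge R N n) := DeRham {
  dr_form : 'M[K]_N;
  dr_fil : int -> 'M[K]_N;
  dr_comp : {rmorphism K -> R[i]} -> 'M[R[i]]_N;
  dr_form_nondeg : dr_form \in unitmx;
  dr_fil_decr : forall p : int, (dr_fil (p + 1)%R <= dr_fil p)%MS;
  dr_comp_unit : forall s, dr_comp s \in unitmx;
  dr_comp_form : forall (s : {rmorphism K -> R[i]}) (v w : 'rV[R[i]]_N),
    bil (map_mx s dr_form) (act (dr_comp s) v) (act (dr_comp s) w) =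
    ((2 * trigo.pi)%:C%C * 'i) ^ (- n) * bil (map_mx ratr (ph_form H)) v w;
  dr_comp_fil : forall (s : {rmorphism K -> R[i]}) (p : int),
    (hodge_fil H p *m (dr_comp s)^T :=: map_mx s (dr_fil p))%MS
}.

(** The embedding of [D] in the endomorphisms of [V_DR (x) Kbar].  Its
    compatibility with the comparison isomorphism for [s : K -> C] refers to
    an extension [dra_ext s] of [s] to the algebraic closure. *)
Record deRham_action (R : realType) (K : fieldType) (Kbar : algClosure K)
    (N : nat) (n : int) (H : polarized_hodge R N n) (DR : deRham K H)
    (D : {pred 'M[rat]_N}) := DeRhamAction {
  dra_map : 'M[rat]_N -> 'M[Kbar]_N;
  dra_ext : {rmorphism K -> R[i]} -> {rmorphism Kbar -> R[i]};
  dra_extE : forall s x, dra_ext s (ac_emb Kbar x) = s x;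
  dra_inj : {in D &, injective dra_map};
  dra1 : dra_map 1%:M = 1%:M;
  draB : {in D &, {morph dra_map : A B / A - B}};
  draM : {in D &, {morph dra_map : A B / A *m B}};
  dra_comp : forall s, {in D, forall A,
    map_mx (dra_ext s) (dra_map A) *m dr_comp DR s =
    dr_comp DR s *m map_mx ratr A}
}.

(** The decomposition [V (x) C = V_DR (x)_(K,s) C = (+) G^i V_DR (x) C]: the
    image of [V^(i,n-i)] is the summand that maps isomorphically onto
    [G^i V_DR (x) C]. *)
Definition deRham_piece (R : realType) (K : fieldType) (N : nat) (n : int)
    (H : polarized_hodge R N n) (DR : deRham K H) (s : {rmorphism K -> R[i]})
    (p : int) : 'M[R[i]]_N :=
  ph_comp H p *m (dr_comp DR s)^T.

Definition preserves_deRham (R : realType) (K : fieldType)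
    (Kbar : algClosure K) (N : nat) (n : int) (H : polarized_hodge R N n)
    (DR : deRham K H) (D : {pred 'M[rat]_N}) (E : deRham_action Kbar DR D) :
    Prop :=
  forall (s : {rmorphism K -> R[i]}) (p : int), {in D, forall A,
    (deRham_piece DR s p *m (map_mx (dra_ext E s) (dra_map E A))^T
      <= deRham_piece DR s p)%MS}.

(** A Hodge-Tate decomposition
    [V_l (x) C_l = (+)_i G^i V_DR (x)_K C_l(i - n)], compatible with [D].  The
    isomorphism restricted to [G^i V_DR (x) C_l] is the map induced by
    [f i : F^i V_DR (x) C_l -> V_l (x) C_l], of kernel
    [F^(i+1) V_DR (x) C_l]. *)
Record HT_decomposition (R : realType) (K : fieldType) (Kbar : algClosure K)
    (l : primenat) (Ql : padicField R l) (lam : set K)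
    (C : Cl_completion Kbar Ql lam) (N : nat) (n : int)
    (H : polarized_hodge R N n) (DR : deRham K H)
    (rho : padic_rep Kbar Ql N) (f : int -> 'M[C]_N) : Prop := {
  HT_ker : forall (p : int) (y : 'rV[C]_N),
    (y <= map_mx (Cl_emb C \o ac_emb Kbar) (dr_fil DR p))%MS ->
    act (f p) y = 0 <->
    (y <= map_mx (Cl_emb C \o ac_emb Kbar) (dr_fil DR (p + 1)%R))%MS;
  HT_sum : exists m : nat, internal_sum m (fun p =>
    map_mx (Cl_emb C \o ac_emb Kbar) (dr_fil DR p) *m (f p)^T);
  HT_gal : forall (p : int) (x : 'rV[K]_N) (g : absgal Kbar),
    (x <= dr_fil DR p)%MS -> Cl_decomposition C g ->
    Cl_semilinear rho g (act (f p) (map_mx (Cl_emb C \o ac_emb Kbar) x)) =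
    Cl_Ql C (cyclo Ql g) ^ (p - n) *:
      act (f p) (map_mx (Cl_emb C \o ac_emb Kbar) x)
}.

Definition HT_compatible (R : realType) (K : fieldType) (Kbar : algClosure K)
    (l : primenat) (Ql : padicField R l) (lam : set K)
    (C : Cl_completion Kbar Ql lam) (N : nat) (n : int)
    (H : polarized_hodge R N n) (DR : deRham K H)
    (D : {pred 'M[rat]_N}) (E : deRham_action Kbar DR D)
    (f : int -> 'M[C]_N) : Prop :=
  forall (p : int) (y : 'rV[C]_N),
  (y <= map_mx (Cl_emb C \o ac_emb Kbar) (dr_fil DR p))%MS ->
  {in D, forall A,
    act (f p) (act (map_mx (Cl_emb C) (dra_map E A)) y) =
    act (map_mx (Cl_Ql C \o Qp_emb Ql) A) (act (f p) y)}.

(** Linear algebraic groups over [Q_l] are given by their points in an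
    algebraic closure (no information is lost: in characteristic 0 they are
    smooth), which carry the Zariski topology. *)

Definition mx_eval (F : fieldType) (N : nat) (p : {mpoly F[N * N]})
    (A : 'M[F]_N) : F :=
  p.@[fun k => mxvec A 0 k].

Definition zariski (F : fieldType) (N : nat) : Type := 'M[F]_N.

Section Zariski.
Variables (F : fieldType) (N : nat).

HB.instance Definition _ := Choice.on (zariski F N).

Definition zlocus (I : set ({mpoly F[N * N]})) : set (zariski F N) :=
  [set A | forall p, I p -> mx_eval p A = 0].

Definition zopen : set_system (zariski F N) :=
  [set U | exists I, U = ~` zlocus I].

Lemma zopenT : zopen setT.
Proof.
exists setT; apply/seteqP; split => // A _ /(_ 1 I) /eqP.
by rewrite /mx_eval meval1 oner_eq0.
Qed.

Lemma zopenI : setI_closed zopen.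
Proof.
move=> _ _ [I ->] [J ->].
exists [set r | exists p q, [/\ I p, J q & r = p * q]].
rewrite -setCU; congr (~` _); apply/seteqP; split => A.
  move=> /= AIJ _ [p [q [Ip Jq ->]]]; rewrite /mx_eval mevalM.
  by case: AIJ => [/(_ p Ip)|/(_ q Jq)]; rewrite /mx_eval => ->;
    rewrite ?mul0r ?mulr0.
move=> /= AIJ; apply: contrapT => /not_orP [].
move=> /existsNP [p /not_implyP [Ip p0]] /existsNP [q /not_implyP [Jq q0]].
have /eqP : mx_eval (p * q) A = 0 by apply: AIJ; exists p, q.
by rewrite /mx_eval mevalM mulf_eq0 => /orP [] /eqP.
Qed.

Lemma zopen_bigU (T : Type) (f : T -> set (zariski F N)) :
  (forall i, zopen (f i)) -> zopen (\bigcup_i f i).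
Proof.
move=> fo; exists [set p | exists2 I, (exists i, f i = ~` zlocus I) & I p].
apply/seteqP; split => A.
  move=> [i _ fiA]; have [I fiE] := fo i => A0.
  move: fiA; rewrite fiE; apply => p Ip; apply: A0; exists I => //.
  by exists i.
move=> /existsNP [p /not_implyP [[I [i fiE] Ip] p0]].
by exists i => //; rewrite fiE => /(_ p Ip).
Qed.

HB.instance Definition _ :=
  isOpenTopological.Build (zariski F N) zopenT zopenI zopen_bigU.

Definition zcomponent (G : set 'M[F]_N) (A : 'M[F]_N) : set 'M[F]_N :=
  @connected_component (zariski F N) G A.

Definition id_component (G : set 'M[F]_N) : set 'M[F]_N := zcomponent G 1%:M.

Definition mulset (A B : set 'M[F]_N) : set 'M[F]_N :=
  [set a *m b | a in A & b in B].

(** [pi_0 G] is the set of connected components of [G] (i.e. of cosets of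
    its identity component), with [mulset] as group law. *)
Definition pi0 (G : set 'M[F]_N) : set (set 'M[F]_N) :=
  [set zcomponent G A | A in G].

(** The map [pi_0 G' -> pi_0 G] induced by an inclusion of [G'] in [G]: it
    sends a component of [G'] to the component of [G] that contains it. *)
Definition pi0_incl (G : set 'M[F]_N) (X : set 'M[F]_N) : set 'M[F]_N :=
  \bigcup_(A in X) zcomponent G A.

Definition pi0_hom (G' G : set 'M[F]_N)
    (f : set 'M[F]_N -> set 'M[F]_N) : Prop :=
  set_fun (pi0 G') (pi0 G) f /\
  forall X Y, pi0 G' X -> pi0 G' Y -> f (mulset X Y) = mulset (f X) (f Y).

Definition pi0_epi (G' G : set 'M[F]_N)
    (f : set 'M[F]_N -> set 'M[F]_N) : Prop :=
  pi0_hom G' G f /\ set_surj (pi0 G') (pi0 G) f.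

Definition pi0_ker (G' G : set 'M[F]_N) (f : set 'M[F]_N -> set 'M[F]_N) :
    set (set 'M[F]_N) :=
  [set X | pi0 G' X /\ f X = id_component G].

Definition GIso (Psi : 'M[F]_N) : set 'M[F]_N :=
  [set A | A \in unitmx /\ exists2 c : F, c != 0 &
    forall v w : 'rV[F]_N, bil Psi (act A v) (act A w) = c * bil Psi v w].

Definition Iso (Psi : 'M[F]_N) : set 'M[F]_N :=
  [set A | A \in unitmx /\
    forall v w : 'rV[F]_N, bil Psi (act A v) (act A w) = bil Psi v w].

End Zariski.

Section Galg.
Variables (R : realType) (K : fieldType) (Kbar : algClosure K).
Variables (l : primenat) (Ql : padicField R l) (Qlbar : algClosure Ql).
Variables (N : nat) (Psi : 'M[rat]_N) (rho : padic_rep Kbar Ql N).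

Definition Psi_bar : 'M[Qlbar]_N :=
  map_mx (ac_emb Qlbar \o Qp_emb Ql) Psi.

(** The Zariski closure over [Q_l] of [rho U] in the group of similitudes. *)
Definition Galg (U : set (absgal Kbar)) : set 'M[Qlbar]_N :=
  [set A | GIso Psi_bar A /\
    forall p : {mpoly Ql[N * N]},
      (forall g, U g -> mx_eval p (rho g) = 0) ->
      mx_eval (map_mpoly (ac_emb Qlbar) p) A = 0].

Definition Galg1 (U : set (absgal Kbar)) : set 'M[Qlbar]_N :=
  Galg U `&` Iso Psi_bar.

End Galg.

Arguments Galg {R K Kbar l Ql} Qlbar {N} Psi rho U.
Arguments Galg1 {R K Kbar l Ql} Qlbar {N} Psi rho U.

(* Main.v *)
From HB Require Import structures.
From mathcomp Require Import all_boot all_order all_fingroup all_algebra all_field.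
From mathcomp Require Import finmap.
From mathcomp Require Import boolp classical_sets functions cardinality reals.
From mathcomp Require Import filter topology_structure connected.
From mathcomp Require Import complex mpoly.
From mathcomp Require Import ring zify.
Require Import Defs.

Set Implicit Arguments.
Unset Strict Implicit.
Unset Printing Implicit Defensive.
Import Order.TTheory GRing.Theory Num.Theory.
Local Open Scope classical_set_scope.
Local Open Scope ring_scope.

(** Let [G] and [G1] be the Zariski closure of the image of [rho_l] and its
    subgroup of isometries.  The point is that [G] contains all homotheties.
    There is a prime [v] outside any given finite set, and a Frobenius element
    [f] at [v]; by (R2) the eigenvalues of [rho_l f] have all their conjugates
    of absolute value [r = q_v ^ (- n / 2) <> 1].  A polynomial [p] that
    vanishes on all the powers [rho_l f ^ k] does so degree by degree: the
    degree [d] part is a sequence in [k] that satisfies a linear recurrence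
    with characteristic roots of absolute value [r ^ d], so that the different
    parts are linearly independent.  At [k = 0] this shows that [p] vanishes on
    the homotheties.

    Since the identity component [G^0] contains the homotheties, the closure of
    [rho_l (G_K0)], which is [G^0] because [K0 / K] is finite, is the image of
    [Gm x X] with [X = G^0 :&: Iso].  A relatively clopen part [B = - B] of [X]
    has a relatively clopen cone [Gm B] in [G^0], hence is empty or all of [X];
    it follows that [X] consists of its identity component [G1^0] and of
    [- G1^0].  As [G = Gm G1], the map on components is onto, with kernel
    [X / G1^0].

    The Frobenius element is obtained from a maximal ideal [P] of the ring of
    all algebraic integers of [Kbar], on each finite family of integers first,
    and then by means of an ultrafilter on the finite families. *)

(** * Polynomials over a subfield *)

Section FieldExt.
Variables (F L : fieldType) (iota : {rmorphism F -> L}).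
Local Notation "p ^i" := (map_poly iota p) (at level 2, format "p ^i").

(** A nonzero annihilator of least size divides all others, since the remainder of a division by it
    is a smaller annihilator. This divisibility carries relations at [z] over to every other root of
    [m]. *)
Lemma annihilator_generator (z : L) : algebraicOver iota z ->
  exists m : {poly F}, [/\ m \is monic, root m^i z &
    forall f, root f^i z -> m %| f].
Proof.
move=> algz.
pose P k := `[< exists2 p : {poly F}, p != 0 & root p^i z /\ size p = k >].
have ex : exists k, P k.
  by have [p p0 pz] := algz; exists (size p); apply/asboolP; exists p.
case: (ex_minnP ex) => k /asboolP [p p0 [pz szp]] kmin.
exists ((lead_coef p)^-1 *: p).
have lc0 : (lead_coef p)^-1 != 0 by rewrite invr_eq0 lead_coef_eq0.
split.
- by rewrite monicE lead_coefZ mulVf // lead_coef_eq0.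
- by rewrite map_polyZ rootZ // fmorph_eq0.
- move=> f fz; rewrite dvdpZl // /dvdp; apply: contraT => r0.
  have : (k <= size (f %% p)%R)%N.
    apply: kmin; apply/asboolP; exists (f %% p) => //; split=> //.
    rewrite /root map_modp; move: fz; rewrite {1}(divp_eq f^i p^i) /root.
    by rewrite hornerD hornerM (rootP pz) mulr0 add0r.
  by rewrite leqNgt -szp ltn_modp p0.
Qed.

(** Elements are adjoined one at a time by the primitive element theorem. Computations with finitely
    many algebraic elements thus become computations with polynomials in a single [z]. *)
Lemma primitive_element (s : seq L) : [pchar F] =i pred0 ->
  (forall x, x \in s -> algebraicOver iota x) ->
  exists2 z, algebraicOver iota z &
    forall x, x \in s -> exists h : {poly F}, h^i.[z] = x.
Proof.
move=> pF; elim: s => [|x s IH] algs.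
  by exists 0 => //; exact: algebraic0.
have [|z algz zs] := IH.
  by move=> y ys; apply: algs; rewrite inE ys orbT.
have [|p p0 px] := algs x; first by rewrite inE eqxx.
have [q q0 qz] := algz.
have [n [[rx Drx] [rz Drz]]] := pchar0_PET p0 px q0 qz pF.
exists (z *+ n - x).
  apply: algebraic_sub; last by exists p.
  rewrite -mulr_natl; apply: algebraic_mul => //.
  by rewrite -(rmorph_nat iota); exact: algebraic_id.
move=> y; rewrite inE => /predU1P [->|/zs [h <-]]; first by exists rx.
exists (h \Po rz); rewrite map_comp_poly horner_comp.
by rewrite Drz.
Qed.

End FieldExt.

(* The coefficients of [m] are, up to sign, the elementary symmetric functions
   of [cs], of which any symmetric polynomial is a polynomial. *)
Lemma prod_roots_descent (A B : idomainType) (J : {rmorphism A -> B})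
    (cs : seq B) (m : {poly A}) :
  map_poly J m = \prod_(c <- cs) ('X - c%:P) ->
  forall G : {poly A}, exists a, \prod_(c <- cs) (map_poly J G).[c] = J a.
Proof.
move=> Dm G; pose n := size cs; pose ct := in_tuple cs.
pose Phi : {mpoly A[n]} := \prod_(i < n) (map_poly (@mpolyC n A) G).['X_i].
have symPhi : Phi \is symmetric.
  apply/issymP => s; rewrite /Phi rmorph_prod /=.
  rewrite [RHS](reindex_inj (@perm_inj _ s)) /=; apply: eq_bigr => i _.
  rewrite -horner_map /= -map_poly_comp msymX.
  congr (_.[_]); last first.
    congr 'X_[_]; apply/mnmP => k; rewrite mnmE !mnm1E.
    by rewrite -(inj_eq (@perm_inj _ s)) permKV.
  by apply: eq_map_poly => c /=; rewrite /msym mmapC.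
have [t [Dt _]] := sym_fundamental symPhi.
pose ev := mmap J (tnth ct).
have evPhi : ev Phi = \prod_(c <- cs) (map_poly J G).[c].
  rewrite /ev rmorph_prod /= (big_nth 0) big_mkord; apply: eq_bigr => i _.
  rewrite -horner_map /= -map_poly_comp; congr (_.[_]).
    by apply: eq_map_poly => c /=; rewrite mmapC.
  by rewrite mmapX mmap1U (tnth_nth 0).
(* The [i]-th variable of [t] stands for the elementary symmetric function of degree [i.+1], which
   is up to sign the coefficient of degree [n - i.+1] of [m]. *)
pose b (i : 'I_n) := (-1) ^+ i.+1 * m`_(n - i.+1).
exists t.@[b]; rewrite -evPhi -Dt comp_mpolyEX.
have -> : t.@[b] = \sum_(k <- msupp t) t@_k * 'X_[k].@[b].
  by rewrite {1}(mpolyE t) raddf_sum; apply: eq_bigr => k _; rewrite /= mevalZ.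
rewrite /ev !raddf_sum; apply: eq_bigr => k _; rewrite /= mevalX mmapZ comp_mpolyX.
rewrite rmorphM rmorph_prod [in RHS]rmorph_prod; congr (_ * _).
apply: eq_bigr => i _ /=; rewrite !rmorphXn /=; congr (_ ^+ _).
rewrite tnth_map tnth_ord_tuple /b rmorphM rmorph_sign -coef_map Dm.
have ltin : (i.+1 < n.+1)%N by rewrite ltnS.
have /= -> := mroots_coeff ct (Ordinal ltin).
rewrite mulrA -expr2 sqrr_sign mul1r.
rewrite !mesymE !raddf_sum; apply: eq_bigr => h _ /=.
by rewrite mmapX mevalX.
Qed.

(** * Algebraic integers and Frobenius conjugates *)

Section RingOfIntegers.
Variable E : fieldType.

Definition int_pred : {pred E} := fun x => `[< integers E x >].

Lemma int_pred_subring : subring_closed int_pred.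
Proof.
split=> [|x y /asboolP xi /asboolP yi|x y /asboolP xi /asboolP yi].
- by apply/asboolP; exact: integral1.
- by apply/asboolP; exact: integral_sub.
- by apply/asboolP; exact: integral_mul.
Qed.

HB.instance Definition _ :=
  GRing.isSubringClosed.Build E int_pred int_pred_subring.

(** The integers as a type of their own: reduction modulo a prime can then be a ring morphism on
    it. *)
Record intring := IntRing { int_val : E; int_valP : int_val \in int_pred }.
HB.instance Definition _ := [isSub for int_val].
HB.instance Definition _ := [Choice of intring by <:].
HB.instance Definition _ := [SubChoice_isSubComNzRing of intring by <:].
HB.instance Definition _ :=
  GRing.RMorphism.copy int_val (\val : intring -> E).

Lemma int_val_integers (x : intring) : integers E (int_val x).
Proof. by apply/asboolP; exact: int_valP. Qed.

Lemma lift_integer (x : E) : integers E x -> exists y : intring, int_val y = x.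
Proof. by move=> xi; exists (IntRing (asboolT xi)). Qed.

End RingOfIntegers.

Lemma integers_map (E F : fieldType) (f : {rmorphism E -> F}) (x : E) :
  integers E x -> integers F (f x).
Proof.
move=> [p pm px]; exists p => //.
have -> : map_poly intr p = map_poly f (map_poly intr p).
  by rewrite -map_poly_comp; apply: eq_map_poly => c /=; rewrite rmorph_int.
exact: rmorph_root.
Qed.

Lemma integers_map_inv (E F : fieldType) (f : {rmorphism E -> F}) (x : E) :
  integers F (f x) -> integers E x.
Proof.
move=> [p pm px]; exists p => //; rewrite -(fmorph_root f) -map_poly_comp.
by rewrite (eq_map_poly (g := intr)) // => c /=; rewrite rmorph_int.
Qed.

Section QPower.
Variables (A : comNzRingType) (p m : nat).

(** The proof [pA] is an argument so that the ring morphism structure, which relies on it for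
    additivity, can be attached to the function. *)
Definition qpow (pA : p \in [pchar A]) (x : A) := x ^+ (p ^ m).

Lemma qpow_is_zmod_morphism pA : zmod_morphism (qpow pA).
Proof.
move=> x y; rewrite /qpow; have pn : [pchar A].-nat (p ^ m)%N.
  rewrite pnatX pnatE ?pA // (pcharf_prime pA) //.
apply/eqP; rewrite eq_sym subr_eq -exprDn_pchar // subrK //.
Qed.

Lemma qpow_is_monoid_morphism pA : monoid_morphism (qpow pA).
Proof. by rewrite /qpow; split=> [|x y]; rewrite ?expr1n ?exprMn. Qed.

HB.instance Definition _ pA :=
  GRing.isZmodMorphism.Build A A (qpow pA) (qpow_is_zmod_morphism pA).
HB.instance Definition _ pA :=
  GRing.isMonoidMorphism.Build A A (qpow pA) (qpow_is_monoid_morphism pA).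

End QPower.
Arguments qpow {A p} m pA.

(** Both sides are ring morphisms in [f] that agree on constants and on the variable. *)
Lemma qpow_poly (k : comNzRingType) (p m : nat) (pk : p \in [pchar k])
    (f : {poly k}) :
  f ^+ (p ^ m) = map_poly (qpow m pk) f \Po 'X^(p ^ m).
Proof.
have pkX : p \in [pchar {poly k}] by rewrite pchar_poly.
rewrite -[LHS]/(qpow m pkX f); elim/poly_ind: f => [|f c IH].
  by rewrite !rmorph0.
rewrite !rmorphD !rmorphM /= map_polyX map_polyC comp_polyX comp_polyC -IH.
by congr (_ + _); rewrite /qpow -rmorphXn.
Qed.

(** This is [prod_roots_descent] for the coefficientwise extension [J] of [iota] to polynomials in
    two variables [Y] and [X]: the factor attached to [c] is the value at [c] of a single polynomial
    [G] defined over [K]. *)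
Lemma bivariate_descent (K E : fieldType) (iota : {rmorphism K -> E})
    (mu : {poly K}) (cs : seq E) (h : seq {poly K}) :
    map_poly iota mu = \prod_(c <- cs) ('X - c%:P) ->
  exists Z : {poly {poly K}},
    \prod_(c <- cs)
      ('X - (\sum_(i < size h) (map_poly iota h`_i).[c] *: 'X^i)%:P) =
    map_poly (map_poly iota) Z.
Proof.
move=> Dmu.
have [J [JX JC JE]] : exists J : {rmorphism {poly {poly K}} -> {poly {poly E}}},
    [/\ J 'X = 'X, forall f, J f%:P = (map_poly iota f)%:P &
      forall Z, J Z = map_poly (map_poly iota) Z].
  exists (map_poly (map_poly iota)).
  split => // [|f]; first by rewrite /= map_polyX.
  by rewrite /= map_polyC.
pose kA : {rmorphism K -> {poly {poly K}}} := polyC \o polyC.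
pose kB : {rmorphism E -> {poly {poly E}}} := polyC \o polyC.
have JkA x : J (kA x) = kB (iota x) by rewrite /= JC map_polyC.
have mapkA f : map_poly J (map_poly kA f) = map_poly kB (map_poly iota f).
  by rewrite -!map_poly_comp; apply: eq_map_poly.
have DJ : map_poly J (map_poly kA mu) = \prod_(c <- map kB cs) ('X - c%:P).
  rewrite mapkA Dmu big_map rmorph_prod; apply: eq_bigr => c _.
  by rewrite rmorphB /= map_polyX map_polyC.
(* In a third variable [T], this is [X - sum_i Y ^ i h_i(T)]: the constants ['X%:P] and ['X^i%:P%:P]
   are the variables [X] and [Y] of the inner rings. *)
pose G : {poly {poly {poly K}}} := 'X%:P -
  \sum_(i < size h) ('X^i%:P%:P * map_poly kA h`_i).
have [Z DZ] := prod_roots_descent DJ G.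
exists Z; rewrite -JE -DZ big_map; apply: eq_bigr => c _.
rewrite /G rmorphB hornerD hornerN /= map_polyC hornerC /= [in RHS]JX.
rewrite [polyC (\sum_(i < _) _)]rmorph_sum [in RHS]rmorph_sum horner_sum.
congr (_ - _).
apply: eq_bigr => i _; rewrite rmorphM hornerM /= map_polyC hornerC /=.
rewrite mapkA horner_map /= JC map_polyXn -mul_polyC mulrC.
by rewrite rmorphM.
Qed.

Section FiniteLevel.
Variables (K : fieldType) (E : closedFieldType) (iota : {rmorphism K -> E}).
Variables (k : idomainType) (red : {rmorphism intring E -> k}).
Variables (p m : nat).
Hypothesis pk : p \in [pchar k].
Hypothesis red_base : forall (x : intring E) (a : K),
  int_val x = iota a -> red x ^+ (p ^ m) = red x.

(* With [Theta_c = sum_i (h_i c) Y ^ i] for each root [c] of [mu], the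
   polynomial [F = prod_c (X - Theta_c)] has coefficients in [O_K]; hence,
   modulo the prime, [F(Theta_z) ^ q = 0] is the product over [c] of
   [Theta_z ^ q - Theta_c(Y ^ q)], where one of the factors vanishes. *)
Lemma frobenius_conjugate (z : E) (mu : {poly K}) (h : seq {poly K}) :
    mu \is monic -> root (map_poly iota mu) z ->
    (forall f, root (map_poly iota f) z -> mu %| f) ->
    (forall f, f \in h -> integers E (map_poly iota f).[z]) ->
  exists2 z', root (map_poly iota mu) z' &
    forall f (y : intring E), f \in h -> int_val y = (map_poly iota f).[z] ->
    exists2 y' : intring E, int_val y' = (map_poly iota f).[z'] &
      red y' = red y ^+ (p ^ m).
Proof.
move=> mu_monic muz mu_dvd hint.
have [cs] := closed_field_poly_normal (map_poly iota mu).
rewrite (monicP (monic_map _ mu_monic)) scale1r => Dmu.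
have cs_root c : c \in cs -> root (map_poly iota mu) c.
  by rewrite Dmu root_prod_XsubC.
have zcs : z \in cs by rewrite -root_prod_XsubC -Dmu.
have transfer c f : c \in cs -> root (map_poly iota f) z ->
    root (map_poly iota f) c.
  move=> /cs_root muc /mu_dvd /dvdpP [g ->].
  by rewrite rmorphM rootM muc orbT.
(* The monic equation of the value of [f] at [z], composed with [f], is a relation over [K]
   satisfied by [z]; it passes to the conjugate [c]. *)
have cint c f : c \in cs -> f \in h -> integers E (map_poly iota f).[c].
  move=> ccs fh; have [r rm rz] := hint f fh.
  exists r => //.
  have Dr : map_poly intr r = map_poly iota (map_poly intr r).
    by rewrite -map_poly_comp; apply: eq_map_poly => x /=; rewrite rmorph_int.
  rewrite Dr /root -horner_comp -map_comp_poly.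
  apply: transfer => //.
  by rewrite /root map_comp_poly horner_comp -Dr.
(* For [c] in [cs] and [i < size h] the value is integral by [cint], and the default [0] does not
   occur. *)
pose hv c i : intring E := insubd 0 (map_poly iota h`_i).[c].
have hvE c i : c \in cs -> (i < size h)%N ->
    int_val (hv c i) = (map_poly iota h`_i).[c].
  move=> ccs ih; rewrite /hv -[int_val _]/(val _) val_insubd ifT //.
  by apply: asboolT; apply: cint => //; rewrite mem_nth.
pose n := size h.
pose Theta c : {poly intring E} := \poly_(i < n) hv c i.
pose F := \prod_(c <- cs) ('X - (Theta c)%:P).
have Fbase a b : exists x : K, int_val F`_a`_b = iota x.
  have [Z DZ] := bivariate_descent h Dmu.
  have : map_poly (map_poly (@int_val E)) F = map_poly (map_poly iota) Z.
    rewrite -DZ rmorph_prod big_seq [RHS]big_seq; apply: eq_bigr => c ccs.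
    rewrite rmorphB /= map_polyX map_polyC /=; congr ('X - polyC _).
    rewrite /Theta poly_def rmorph_sum; apply: eq_bigr => i _.
    by rewrite /= map_polyZ map_polyXn /= hvE.
  move/(congr1 (fun P : {poly {poly E}} => P`_a`_b)); rewrite !coef_map /=.
  by move=> ->; exists Z`_a`_b.
pose rb := map_poly red; pose Fb := map_poly rb F.
have FbE : Fb = \prod_(c <- cs) ('X - (rb (Theta c))%:P).
  rewrite /Fb rmorph_prod; apply: eq_bigr => c _.
  by rewrite rmorphB /= map_polyX map_polyC.
have pkX : p \in [pchar {poly k}] by rewrite pchar_poly.
pose phi : {rmorphism {poly k} -> {poly k}} := qpow m pkX.
pose psi : {rmorphism {poly k} -> {poly k}} := comp_poly 'X^(p ^ m).
(* The coefficients of [Fb] in [k] come from [K], hence are fixed by the power [p ^ m]; raising to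
   this power therefore only substitutes [Y ^ (p ^ m)] for [Y]. *)
have phi_psi : map_poly phi Fb = map_poly psi Fb.
  apply/polyP => a; rewrite !coef_map /=.
  rewrite [LHS](qpow_poly m pk); congr (_ \Po _).
  apply/polyP => b; rewrite !coef_map /=.
  by have [x Dx] := Fbase a b; exact: red_base Dx.
have : (map_poly psi Fb).[phi (rb (Theta z))] = 0.
  rewrite -phi_psi horner_map /=; apply/eqP.
  rewrite (_ : Fb.[_] = 0) ?rmorph0 //; apply/rootP.
  rewrite FbE -(big_map (fun c => rb (Theta c)) xpredT (fun t => 'X - t%:P)).
  by rewrite root_prod_XsubC (map_f (fun c => rb (Theta c))).
move/rootP; rewrite FbE rmorph_prod.
have -> : \prod_(c <- cs) map_poly psi ('X - (rb (Theta c))%:P) =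
          \prod_(t <- [seq psi (rb (Theta c)) | c <- cs]) ('X - t%:P).
  rewrite big_map; apply: eq_bigr => c _.
  by rewrite rmorphB /= map_polyX map_polyC.
rewrite root_prod_XsubC => /mapP [c ccs].
rewrite [LHS](qpow_poly m pk) => /eqP.
(* Substituting the nonconstant polynomial ['X^(p ^ m)] is injective, so it can be cancelled; the
   coefficients for [c] are then the powers of those for [z]. *)
rewrite -subr_eq0 -comp_polyB comp_poly_eq0; last first.
  by rewrite size_polyXn ltnS expn_gt0 prime_gt0 // (pcharf_prime pk).
rewrite subr_eq0 => /eqP Dc.
exists c; first exact: cs_root.
move=> f y fh Dy; pose i := index f h.
have ltin : (i < n)%N by rewrite index_mem.
exists (hv c i); first by rewrite hvE // nth_index.
have -> : y = hv z i by apply: val_inj; rewrite /= hvE // nth_index.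
move/(congr1 (fun P : {poly k} => P`_i)): Dc.
by rewrite !coef_map !coef_poly ltin.
Qed.

End FiniteLevel.

Section FrobeniusElement.
Variables (K : fieldType) (Kbar : algClosure K).
Let iota := ac_emb Kbar.
Variables (k : idomainType) (red : {rmorphism intring Kbar -> k}) (p m : nat).
Hypothesis pK : [pchar K] =i pred0.
Hypothesis pk : p \in [pchar k].
Hypothesis red_base : forall (x : intring Kbar) (a : K),
  int_val x = iota a -> red x ^+ (p ^ m) = red x.

(** The conditions on a Frobenius automorphism that can be tested inside the finite set [s]. Each
    instance involves finitely many elements, hence survives in a limit along an ultrafilter. *)
Definition frobenius_on (s : seq Kbar) (g : Kbar -> Kbar) : Prop :=
  [/\ forall a, iota a \in s -> g (iota a) = iota a,
      forall x y, x \in s -> y \in s -> x - y \in s -> g (x - y) = g x - g y,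
      forall x y, x \in s -> y \in s -> x * y \in s -> g (x * y) = g x * g y,
      forall x f, x \in s -> root (map_poly iota f) x ->
        root (map_poly iota f) (g x) &
      forall y : intring Kbar, int_val y \in s ->
        exists2 y' : intring Kbar, int_val y' = g (int_val y) &
          red y' = red y ^+ (p ^ m)].

(** The elements of [s] are polynomials in one [z], and [g] replaces [z] by the conjugate [z'] given
    by [frobenius_conjugate]. *)
Lemma exists_frobenius_on (s : seq Kbar) : exists g, frobenius_on s g.
Proof.
have [z algz zs] : exists2 z, algebraicOver iota z &
    forall x, x \in s -> exists h : {poly K}, (map_poly iota h).[z] = x.
  by apply: primitive_element pK _ => x _; exact: ac_alg.
have [mu [mu1 muz mu_dvd]] := annihilator_generator algz.
have hex x : exists f, x \in s -> (map_poly iota f).[z] = x.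
  by case: (boolP (x \in s)) => [/zs [f fE]|_]; [exists f|exists 0].
have [h hE] := choice hex.
pose hs := [seq h x | x <- s & x \in @int_pred Kbar].
have [|z' muz' frz'] := frobenius_conjugate pk red_base (h := hs) mu1 muz mu_dvd.
  move=> f /mapP [x]; rewrite mem_filter => /andP [/asboolP xi xs] ->.
  by rewrite hE.
have transfer f : root (map_poly iota f) z -> root (map_poly iota f) z'.
  by move=> /mu_dvd /dvdpP [u ->]; rewrite rmorphM rootM muz' orbT.
pose g x := (map_poly iota (h x)).[z'].
(* The value of [g] does not depend on the polynomial that represents [x], because [z'] satisfies
   every relation over [K] satisfied by [z]. *)
have gP x f : x \in s -> (map_poly iota f).[z] = x -> g x = (map_poly iota f).[z'].
  move=> xs fz; apply/eqP; rewrite -subr_eq0 -hornerN -hornerD -rmorphB.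
  by apply: transfer; rewrite /root rmorphB hornerD hornerN hE // fz subrr.
exists g; split.
- move=> a as_; rewrite (gP _ a%:P as_) ?map_polyC ?hornerC //.
- move=> x y xs ys xys; rewrite (gP _ (h x - h y) xys).
    by rewrite rmorphB hornerD hornerN.
  by rewrite rmorphB hornerD hornerN !hE.
- move=> x y xs ys xys; rewrite (gP _ (h x * h y) xys).
    by rewrite rmorphM hornerM.
  by rewrite rmorphM hornerM !hE.
- move=> x f xs fx; rewrite /g /root -horner_comp -map_comp_poly.
  by apply: transfer; rewrite /root map_comp_poly horner_comp hE.
- move=> y ys; apply: (frz' (h (int_val y))); last by rewrite hE.
  by apply: map_f; rewrite mem_filter ys andbT; exact: int_valP.
Qed.

(** Compactness: the maps obtained for each finite [s] are glued along an ultrafilter that contains,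
    for each [x], the set of all [s] containing [x]. Each property of the limit is read off on one
    suitable [s]. *)
Lemma exists_frobenius_ext : exists g : absgal Kbar,
  forall y : intring Kbar, exists2 y' : intring Kbar,
    int_val y' = g (int_val y) & red y' = red y ^+ (p ^ m).
Proof.
have [G GP] := choice exists_frobenius_on.
pose cofinal := [set A : set (seq Kbar) |
  exists s0 : seq Kbar, forall s, {subset s0 <= s} -> A s].
have cofinal_proper : ProperFilter cofinal.
  apply: Build_ProperFilter_ex.
    move=> A [s0 s0A]; exists s0; exact: s0A.
  split; first by exists [::].
    move=> A B [s sA] [t tB]; exists (s ++ t) => u stu; split.
      by apply: sA => x xs; apply: stu; rewrite mem_cat xs.
    by apply: tB => x xt; apply: stu; rewrite mem_cat xt orbT.
  by move=> A B AB [s sA]; exists s => u /sA /AB.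
have [U [Uultra cofU]] := ultraFilterLemma cofinal_proper.
have Uin (x : Kbar) : U [set s : seq Kbar | x \in s].
  by apply: cofU; exists [:: x] => s; apply; rewrite inE.
have Uex A : U A -> exists s, A s by move=> UA; exact: (filter_ex UA).
(* For almost all [s] the value [G s x] lies among the finitely many roots of an annihilator of [x],
   and the ultrafilter selects one of them. *)
have glim (x : Kbar) : exists y, U [set s | G s x = y].
  have [f f0 fx] := ac_alg (a := Kbar) x.
  have [rs Drs] := closed_field_poly_normal (map_poly iota f).
  have : U [set s | G s x \in rs].
    apply: filterS (Uin x) => s /= xs; have [_ _ _ /(_ _ _ xs fx) + _] := GP s.
    by rewrite Drs rootZ ?root_prod_XsubC // lead_coef_eq0 map_poly_eq0.
  elim: rs {Drs} => [/Uex [s]//|y rs IH].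
  case: (in_ultra_setVsetC [set s | G s x = y] Uultra) => [|Uny Urs].
    by exists y.
  apply: IH; apply: filterS2 Uny Urs => s /= ny; rewrite inE.
  by case: eqP.
have [g gP] := choice glim.
have g_base a : g (iota a) = iota a.
  have [s [/= <- ais]] := Uex _ (filterI (gP (iota a)) (Uin (iota a))).
  by have [+ _ _ _ _] := GP s; apply.
have g_zmod : zmod_morphism g.
  move=> x y; have [s [/= -[<- xs] [[<- ys] [<- xys]]]] := Uex _
    (filterI (filterI (gP x) (Uin x))
       (filterI (filterI (gP y) (Uin y)) (filterI (gP (x - y)) (Uin (x - y))))).
  by have [_ + _ _ _] := GP s; apply.
have g_monoid : monoid_morphism g.
  split; first by rewrite -(rmorph1 iota) g_base.
  move=> x y; have [s [/= -[<- xs] [[<- ys] [<- xys]]]] := Uex _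
    (filterI (filterI (gP x) (Uin x))
       (filterI (filterI (gP y) (Uin y)) (filterI (gP (x * y)) (Uin (x * y))))).
  by have [_ _ + _ _] := GP s; apply.
have g_root x f : root (map_poly iota f) x -> root (map_poly iota f) (g x).
  have [s [/= <- xs]] := Uex _ (filterI (gP x) (Uin x)).
  by have [_ _ _ + _] := GP s; apply.
have g_red (y : intring Kbar) : exists2 y' : intring Kbar,
    int_val y' = g (int_val y) & red y' = red y ^+ (p ^ m).
  have [s [/= <- ys]] := Uex _ (filterI (gP (int_val y)) (Uin (int_val y))).
  by have [_ _ _ _ +] := GP s; apply.
pose gB := GRing.isZmodMorphism.Build Kbar Kbar g g_zmod.
pose gM := GRing.isMonoidMorphism.Build Kbar Kbar g g_monoid.
pose gr : {rmorphism Kbar -> Kbar} := HB.pack g gB gM.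
have g_inj : injective gr by exact: fmorph_inj.
(* The finite set of roots of an annihilator of [y] is mapped injectively into itself, hence onto
   itself. *)
have g_surj y : exists x, gr x = y.
  have [f f0 fy] := ac_alg (a := Kbar) y.
  have [rs Drs] := closed_field_poly_normal (map_poly iota f).
  have rsE x : root (map_poly iota f) x = (x \in undup rs).
    by rewrite Drs rootZ ?root_prod_XsubC ?mem_undup // lead_coef_eq0 map_poly_eq0.
  have sub : {subset map gr (undup rs) <= undup rs}.
    by move=> _ /mapP [x xrs ->]; rewrite -rsE g_root ?rsE.
  have [_ eqrs] := uniq_min_size (etrans (map_inj_uniq g_inj _) (undup_uniq rs))
    sub (eq_leq (esym (size_map _ _))).
  by move: fy; rewrite rsE -eqrs => /mapP [x _ ->]; exists x.
have [ginv ginvP] := choice g_surj.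
have g_bij : bijective gr.
  by exists ginv => // x; apply: g_inj; rewrite ginvP.
by exists (AbsGal g_bij g_base).
Qed.

End FrobeniusElement.

(** * Residue fields *)

Section FiniteSubdomain.
Variables (k : idomainType) (s : seq k) (s_subring : subring_closed (mem s)).

Definition seq_subring (_ : subring_closed (mem s)) : Type := seq_sub s.
Local Notation T := (seq_subring s_subring).

HB.instance Definition _ := SubFinite.copy T (seq_sub s).
HB.instance Definition _ :=
  GRing.SubChoice_isSubComNzRing.Build k (mem s) T s_subring.
HB.instance Definition _ := FinRing.isNzRing.Build T.

Lemma seq_subring_domain (x y : T) : x * y = 0 -> (x == 0) || (y == 0).
Proof.
move=> /(congr1 val); rewrite rmorphM rmorph0 => /eqP.
by rewrite mulf_eq0 -!(rmorph0 (\val : T -> k)) !(inj_eq val_inj).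
Qed.

(** A finite domain is a field, so its order is a power of [p] and its elements are fixed by raising
    to that power. *)
Lemma card_finite_subdomain (p : nat) : p \in [pchar k] -> uniq s ->
  exists m, size s = (p ^ m)%N /\ forall x, x \in s -> x ^+ (p ^ m) = x.
Proof.
move=> pk us; pose F := FinDomainFieldType seq_subring_domain.
have pF : p \in [pchar F].
  have /andP [p_pr _] := pk; rewrite inE p_pr; apply/eqP/val_inj.
  by rewrite (rmorph_nat (\val : T -> k)) rmorph0 (pcharf0 pk).
have cardF : #|F| = size s by rewrite -(card_seq_sub us).
have cardFp := card_pprimeChar pF.
exists (logn p #|F|); split; first by rewrite -cardF; exact: cardFp.
move=> x xs; rewrite -cardFp.
have := congr1 (\val : T -> k) (expf_card (SeqSub xs : F)).
by rewrite (rmorphXn (\val : T -> k)).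
Qed.

End FiniteSubdomain.

Lemma finite_roots (k : idomainType) (f : {poly k}) : f != 0 ->
  exists rs : seq k, forall x, root f x -> x \in rs.
Proof.
have [n] := ubnP (size f); elim: n f => // n IH f szf f0.
have [[a fa]|nroot] := pselect (exists a, root f a); last first.
  by exists [::] => x fx; case: nroot; exists x.
have [g Dg] := factor_theorem f a fa.
have g0 : g != 0 by apply: contraNneq f0 => g0; rewrite Dg g0 mul0r.
have [|//|rs rsP] := IH g.
  by move: szf; rewrite Dg size_Mmonic ?monicXsubC // size_XsubC addn2.
exists (a :: rs) => x; rewrite Dg rootM root_XsubC inE orbC.
by case/orP => [->//|/rsP ->]; rewrite orbT.
Qed.

Section MaximalIdeal.
Variables (R : comNzRingType) (a : R).
Hypothesis a_nunit : forall b, a * b != 1.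

(** The field is the quotient by a maximal ideal containing [a], which Zorn's lemma provides. *)
Lemma exists_residue_field :
  exists (k : fieldType) (red : {rmorphism R -> k}), red a = 0.
Proof.
(* The last clause asks for [a] only when [I] is nonempty: the union of the empty chain must qualify
   in Zorn's lemma. *)
pose ideal (I : set R) := [/\ forall x y, I x -> I y -> I (x - y),
  forall r x, I x -> I (r * x), ~ I 1 & forall x, I x -> I a].
have [M [[MB MM M1 Ma] Mmax]] : exists M, ideal M /\
    forall I, M `<` I -> ~ ideal I.
  apply: Zorn_bigcup => F FP Ftot; split.
  - move=> x y [I FI Ix] [J FJ Jy].
    have [IJ|JI] := Ftot _ _ FI FJ.
      by exists J => //; have [+ _ _ _] := FP _ FJ; apply => //; exact: IJ.
    by exists I => //; have [+ _ _ _] := FP _ FI; apply => //; exact: JI.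
  - by move=> r x [I FI Ix]; exists I => //; have [_ + _ _] := FP _ FI; apply.
  - by move=> [I FI I1]; have [_ _ /(_ I1)] := FP _ FI.
  - by move=> x [I FI Ix]; exists I => //; have [_ _ _ /(_ _ Ix)] := FP _ FI.
(* If [a] is not in [M], then [M] is empty, hence strictly contained in the ideal generated by [a],
   which is proper since [a] is not a unit. *)
have {}Ma : M a.
  apply: contrapT => nMa.
  apply: (Mmax [set x | exists b, x = a * b]).
    split; first by move=> x Mx; case: nMa; exact: Ma Mx.
    by move=> /(_ a) sub; apply: nMa; apply: sub; exists 1; rewrite mulr1.
  split.
  - by move=> _ _ [b ->] [c ->]; exists (b - c); rewrite mulrBr.
  - by move=> r _ [b ->]; exists (r * b); rewrite mulrCA.
  - by move=> [b /esym /eqP]; rewrite (negbTE (a_nunit b)).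
  - by move=> _ _; exists 1; rewrite mulr1.
have M0 : M 0 by rewrite -(subrr a); exact: MB.
have Mcomax x : ~ M x -> exists b, M (1 - x * b).
  move=> nMx; apply: contrapT => nb.
  apply: (Mmax [set y | exists b, M (y - x * b)]).
    split; first by move=> y My; exists 0; rewrite mulr0 subr0.
    move=> /(_ x) sub; apply: nMx; apply: sub.
    by exists 1; rewrite mulr1 subrr.
  split.
  - move=> y z [b yb] [c zc]; exists (b - c).
    by rewrite (_ : _ - _ = y - x * b - (z - x * c)); [exact: MB|ring].
  - move=> r y [b yb]; exists (r * b).
    by rewrite (_ : _ - _ = r * (y - x * b)); [exact: MM|ring].
  - by move=> [b Mb]; apply: nb; exists b.
  - by move=> _ _; exists 0; rewrite mulr0 subr0.
pose I : {pred R} := fun x => `[< M x >].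
have Izmod : zmod_closed I.
  by split=> [|x y /asboolP xI /asboolP yI]; apply/asboolP => //; exact: MB.
have Iproper : 1 \notin I /\ forall r, {in I, forall x, r * x \in I}.
  split; first by apply/asboolPn.
  by move=> r x /asboolP xI; apply/asboolP; exact: MM.
pose IaM := GRing.isZmodClosed.Build _ I Izmod.
pose IpM := isProperIdeal.Build _ I Iproper.
pose Iid : idealr _ := HB.pack I IaM IpM.
pose Q : comNzRingType := {ideal_quot Iid}.
pose pQ : {rmorphism R -> Q} := \pi_Q%qT.
have pQ0 x : (pQ x == 0) = (x \in I).
  by rewrite piE Quotient.equivE subr0.
have Qinv (z : Q) : exists w, (z != 0 -> w * z = 1) /\ (z = 0 -> w = 0).
  have [x ->] : exists x, z = pQ x.
    by exists (generic_quotient.repr z); rewrite /= generic_quotient.reprK.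
  have [Mx|nMx] := pselect (M x).
    have /eqP -> : pQ x == 0 by rewrite pQ0; exact/asboolP.
    by exists 0; rewrite eqxx.
  have [b Mb] := Mcomax _ nMx; exists (pQ b); split.
    move=> _; rewrite -rmorphM mulrC; apply/eqP; rewrite -(rmorph1 pQ) eq_sym.
    by rewrite -subr_eq0 -rmorphB pQ0; apply/asboolP.
  by move=> /eqP; rewrite pQ0 => /asboolP xM; case: nMx.
have [inv invP] := choice Qinv.
pose QF := GRing.ComNzRing_isField.Build Q (fun z => (invP z).1)
  ((invP 0).2 erefl).
pose k : fieldType := HB.pack Q QF.
exists k, pQ; apply/eqP; rewrite -[X in X == _]/(pQ a) pQ0.
exact/asboolP.
Qed.

End MaximalIdeal.

(** If [p * y = 1], multiplying a monic integral equation of [y] of degree [n] by [p ^ n] exhibits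
    [1] as a multiple of [p] among the integers. The morphism [r] ensures that the integers inject
    into [E]. *)
Lemma prime_not_unit_integers (E : fieldType) (r : {rmorphism rat -> E})
  (p : nat) : prime p -> forall y : intring E, p%:R * y != 1.
Proof.
move=> p_pr y; apply/eqP => py1.
have {py1} : p%:R * int_val y = 1 :> E.
  by move/(congr1 (@int_val E)): py1; rewrite rmorphM rmorph_nat rmorph1.
have [f /monicP f1 fy] := int_val_integers y; move: (int_val y) fy => x fx px1.
have intE_inj : injective (intr : int -> E).
  by move=> a b; rewrite -!(rmorph_int r) => /fmorph_inj /intr_inj.
have [n szf] : exists n, size f = n.+1.
  exists (size f).-1; rewrite prednK // lt0n size_poly_eq0.
  by rewrite -lead_coef_eq0 f1.
have : \sum_(i < n.+1) (f`_i * p%:Z ^+ (n - i))%:~R = 0 :> E.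
  have := rootP fx; rewrite horner_coef size_map_inj_poly //.
  move/(congr1 ( *%R (p%:R ^+ n))); rewrite mulr0 mulr_sumr szf => fx0.
  rewrite -[RHS]fx0.
  apply: eq_bigr => i _; rewrite coef_map /= rmorphM rmorphXn /= mulrCA.
  congr (_ * _); have lein : (i <= n)%N by rewrite -ltnS.
  rewrite -[X in _ = _ ^+ X * _](subnK lein) exprD -mulrA -exprMn.
  by rewrite px1 expr1n mulr1.
rewrite -(rmorph_sum intr) -[RHS](rmorph0 intr) => /intE_inj.
rewrite big_ord_recr /= subnn mulr1.
have -> : f`_n = 1 by rewrite -f1 /lead_coef szf.
move=> /eqP; rewrite addrC addr_eq0 => /eqP eq1.
have : (p%:Z %| 1%R)%Z.
  rewrite eq1 rpredN; apply: rpred_sum => i _.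
  by rewrite -(subnSK (ltn_ord i)) exprS mulrCA dvdz_mulr.
by rewrite dvdzE /= dvdn1 => /eqP p1; rewrite p1 in p_pr.
Qed.

Section IntegerMap.
Variables (E F : fieldType) (f : {rmorphism E -> F}).

Definition int_map (x : intring E) : intring F :=
  IntRing (asboolT (integers_map f (int_val_integers x))).

Lemma int_map_is_zmod_morphism : zmod_morphism int_map.
Proof. by move=> x y; apply: val_inj; rewrite /= !rmorphB. Qed.

Lemma int_map_is_monoid_morphism : monoid_morphism int_map.
Proof. by split=> [|x y]; apply: val_inj; rewrite /= ?rmorph1 ?rmorphM. Qed.

HB.instance Definition _ :=
  GRing.isZmodMorphism.Build _ _ int_map int_map_is_zmod_morphism.
HB.instance Definition _ :=
  GRing.isMonoidMorphism.Build _ _ int_map int_map_is_monoid_morphism.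

End IntegerMap.

(** Denominators are cleared in the minimal polynomial, which is then divided by its content.
    Content [1] keeps [w] nonzero modulo every prime, and the bound on its size does not depend on
    [x]. *)
Lemma primitive_annihilator (K : fieldExtType rat) (x : K) :
  exists w : {poly int}, [/\ (size w <= (\dim {:K}).+1)%N, zcontents w = 1 &
    root (map_poly intr w) x].
Proof.
have /polyOver1P [q Dq] := minPolyOver 1 x.
have q0 : q != 0.
  by rewrite -(map_poly_eq0 (in_alg K)) -Dq monic_neq0 ?monic_minPoly.
have szq : (size q <= (\dim {:K}).+1)%N.
  rewrite -(size_map_poly (in_alg K)) -Dq size_minPoly ltnS.
  have := dim_Fadjoin 1 x; rewrite dimv1 muln1 => <-.
  by apply: dimvS; rewrite subvf.
have [r [a a0 Dr]] := rat_poly_scale q.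
have r0 : r != 0 by apply: contraNneq q0 => r0; rewrite Dr r0 rmorph0 scaler0.
have szr : size r = size q.
  rewrite Dr size_scale ?invr_eq0 ?intr_eq0 // size_map_inj_poly //.
  exact: intr_inj.
exists (zprimitive r); split.
- by rewrite size_zprimitive szr.
- by rewrite zcontents_primitive r0.
- have : root (map_poly intr r) x.
    have := root_minPoly 1 x; rewrite Dq Dr map_polyZ rootZ; last first.
      by rewrite fmorph_eq0 invr_eq0 intr_eq0.
    by rewrite -map_poly_comp (eq_map_poly (rmorph_int _)).
  rewrite {1}(zpolyEprim r) map_polyZ rootZ //= -(rmorph_int (in_alg K)).
  by rewrite fmorph_eq0 intr_eq0 zcontents_eq0.
Qed.

(** The reduction of [y] is a root of the reduction of its primitive annihilator [w], a nonzero
    polynomial of bounded size over the prime field. There are finitely many such polynomials, and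
    each has finitely many roots. *)
Lemma finite_residue_image (K : fieldExtType rat) (k : idomainType)
    (red : {rmorphism intring K -> k}) (p : nat) : p \in [pchar k] ->
  exists ss : seq k, forall y, red y \in ss.
Proof.
move=> pk; have p_pr := pcharf_prime pk; pose d := \dim {:K}.
pose poly_of (f : {ffun 'I_d.+1 -> 'I_p}) : {poly k} :=
  \poly_(i < d.+1) (f (inord i))%:R.
have rootsP f : exists rs : seq k,
    forall x, poly_of f != 0 -> root (poly_of f) x -> x \in rs.
  have [->|f0] := eqVneq (poly_of f) 0; first by exists [::].
  by have [rs rsP] := finite_roots f0; exists rs => x _; exact: rsP.
have [rs rsP] := choice rootsP.
exists (flatten [seq rs f | f <- enum {ffun 'I_d.+1 -> 'I_p}]) => y.
have [w [szw w1 wy]] := primitive_annihilator (int_val y).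
have p_gt0 := prime_gt0 p_pr.
pose f : {ffun 'I_d.+1 -> 'I_p} :=
  [ffun i => Ordinal (ltn_pmod `|(w`_(val i) %% p)%Z|%N p_gt0)].
have modE i : ((`|(w`_i %% p)%Z| %% p)%N)%:R = (w`_i)%:~R :> k.
  rewrite modn_small; last first.
    by rewrite -ltz_nat gez0_abs ?modz_ge0 ?ltz_pmod //; lia.
  have pk0 : (p%:Z)%:~R = 0 :> k by exact: pcharf0.
  rewrite [in RHS](divz_eq w`_i p) rmorphD rmorphM /= pk0 mulr0 add0r.
  rewrite -[LHS]/((`|(w`_i %% p)%Z|%N : int)%:~R) gez0_abs // modz_ge0 //; lia.
have fE : poly_of f = map_poly intr w.
  apply/polyP => i; rewrite coef_poly coef_map; case: ltnP => [ltid|ledi].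
    by rewrite ffunE /= inordK // modE.
  by rewrite nth_default ?rmorph0 // (leq_trans szw).
apply/flattenP; exists (rs f); first by rewrite map_f ?mem_enum.
apply: rsP.
  apply: contra_eqN w1 => /eqP f0; apply/eqP => w1.
  have : (p %| zcontents w)%Z.
    rewrite dvdz_contents; apply/polyOverP => i.
    have := congr1 (fun u : {poly k} => u`_i) f0.
    rewrite fE coef_map coef0 /= -modE modn_small; last first.
      by rewrite -ltz_nat gez0_abs ?modz_ge0 ?ltz_pmod //; lia.
    move/eqP; rewrite -(dvdn_pcharf pk) => /dvdn_leq.
    have : (`|(w`_i %% p)%Z| < p)%N.
      by rewrite -ltz_nat gez0_abs ?modz_ge0 ?ltz_pmod //; lia.
    rewrite ltnNge => /negP nle le; apply/dvdz_mod0P/eqP.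
    by rewrite -absz_eq0 -leqn0 leqNgt; apply/negP => /le.
  rewrite w1 dvdzE /= dvdn1 => /eqP p1; by rewrite p1 in p_pr.
rewrite fE.
have -> : map_poly intr w = map_poly red (map_poly intr w).
  by rewrite -map_poly_comp; apply: eq_map_poly => c /=; rewrite rmorph_int.
apply: rmorph_root; apply/rootP/val_inj.
rewrite (rmorph0 (\val : intring K -> K)) -horner_map -map_poly_comp.
rewrite (eq_map_poly (rmorph_int _)); exact/rootP.
Qed.

Section PrimeFromResidue.
Variables (K : fieldExtType rat) (Kbar : algClosure K).
Let iota := ac_emb Kbar.
Variables (k : fieldType) (red : {rmorphism intring Kbar -> k}) (p : nat).
Hypothesis pk : p \in [pchar k].

Let P : set Kbar := [set x | exists2 y : intring Kbar, int_val y = x & red y = 0].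
Let v : set K := [set x | P (iota x)].
Let redK : {rmorphism intring K -> k} := red \o int_map iota.

Let PE (y : intring Kbar) : P (int_val y) <-> red y = 0.
Proof.
by split=> [[z /val_inj ->]//|]; exists y.
Qed.

Let vE (y : intring K) : v (int_val y) <-> redK y = 0.
Proof. exact: (PE (int_map iota y)). Qed.

Let v_int x : v x -> exists2 y : intring K, int_val y = x & redK y = 0.
Proof.
move=> [y Dy ry]; have xi : integers K x.
  by apply: (integers_map_inv (f := iota)); rewrite -Dy; exact: int_val_integers.
have [z Dz] := lift_integer xi; exists z => //.
by apply/vE; rewrite Dz; exists y.
Qed.

Lemma finite_prime_kernel (E : fieldType) (r : {rmorphism intring E -> k})
    (e : {rmorphism rat -> E}) : finite_prime
  [set x | exists2 y : intring E, int_val y = x & r y = 0].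
Proof.
have p_pr := pcharf_prime pk; split.
- by move=> _ [y <- _]; exact: int_val_integers.
- exists p%:R.
    by exists p%:R; [rewrite rmorph_nat|rewrite rmorph_nat (pcharf0 pk)].
  by rewrite -(rmorph_nat e) fmorph_eq0 pnatr_eq0 -lt0n prime_gt0.
- move=> _ _ [y <- ry] [z <- rz]; exists (y + z); first by rewrite rmorphD.
  by rewrite rmorphD ry rz addr0.
- move=> _ _ /lift_integer [a <-] [y <- ry]; exists (a * y).
    by rewrite rmorphM.
  by rewrite rmorphM ry mulr0.
- move=> [y]; rewrite -(rmorph1 (@int_val E)) => /val_inj -> /eqP.
  by rewrite rmorph1 oner_eq0.
- move=> _ _ /lift_integer [a <-] /lift_integer [b <-] [y].
  rewrite -rmorphM => /val_inj -> /eqP; rewrite rmorphM mulf_eq0.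
  by case/orP => /eqP r0; [left; exists a|right; exists b].
Qed.

(** The image [s] of the integers of [K] in [k] is a finite domain of order [p ^ m], which plays the
    role of the residue field of [v]. Its elements are fixed by the power [p ^ m], as
    [exists_frobenius_ext] demands. *)
Lemma exists_frobenius_residue : exists (v : set K) (g : absgal Kbar),
  [/\ finite_prime v, v p%:R, frobenius v g & (1 < prime_norm v)%N].
Proof.
have [ss ssP] := finite_residue_image redK pk.
pose s := [seq c <- undup ss | `[< exists y, redK y = c >]].
have sP c : reflect (exists y, redK y = c) (c \in s).
  rewrite mem_filter mem_undup; apply: (iffP andP) => [[/asboolP//]|[y <-]].
  by split; [apply/asboolP; exists y|exact: ssP].
have us : uniq s by rewrite filter_uniq ?undup_uniq.
have s_subring : subring_closed (mem s).
  split; first by apply/sP; exists 1; rewrite rmorph1.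
    by move=> _ _ /sP [y <-] /sP [z <-]; apply/sP; exists (y - z); rewrite rmorphB.
  by move=> _ _ /sP [y <-] /sP [z <-]; apply/sP; exists (y * z); rewrite rmorphM.
have [m [szs sq]] := card_finite_subdomain s_subring pk us.
(* The class of [y] modulo [v] is the fibre of [redK] through [y], so the classes correspond to the
   elements of [s]. *)
have normE : prime_norm v = (p ^ m)%N.
  rewrite -szs; pose cls (c : k) := [set int_val y | y in [set y | redK y = c]].
  have clsE (y : intring K) :
      [set z | integers K z /\ v (z - int_val y)] = cls (redK y).
    apply/seteqP; split=> z.
      move=> [/lift_integer [u <-]]; rewrite -rmorphB => /vE uy.
      by exists u => //=; apply/eqP; rewrite -subr_eq0 -(rmorphB redK) uy.
    move=> [u /= ruy <-]; split; first exact: int_val_integers.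
    rewrite -rmorphB; apply/vE; apply/eqP.
    by rewrite (rmorphB redK) subr_eq0 [X in X == _]ruy.
  rewrite /prime_norm.
  have -> : [set [set y | integers K y /\ v (y - x)] | x in integers K] =
      cls @` [set` s].
    apply/seteqP; split=> [_ [_ /lift_integer [y <-] <-]|_ [_ /sP [y <-] <-]].
      exists (redK y); last by rewrite clsE.
      by apply/sP; exists y.
    by exists (int_val y); [exact: int_val_integers|exact: clsE].
  have sfin : finite_set [set` s] by [].
  rewrite fset_set_image // card_in_imfset /=.
    rewrite -[RHS](congr1 size (undup_id us)) -card_fseq; congr #|` _|.
    apply/fsetP => c; rewrite in_fset_set // !inE.
    by apply/idP/idP => [/set_mem //|cs]; exact: mem_set.
  move=> c c'; rewrite !in_fset_set // => /set_mem /= /sP [y <-].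
  move=> /set_mem /= /sP [z <-] eqc.
  have : cls (redK y) (int_val y) by exists y.
  by rewrite eqc => -[u ru /val_inj <-].
have red_base (x : intring Kbar) (a : K) :
    int_val x = iota a -> red x ^+ (p ^ m) = red x.
  move=> Dx; have ai : integers K a.
    by apply: (integers_map_inv (f := iota)); rewrite -Dx; exact: int_val_integers.
  have [y Dy] := lift_integer ai; apply: sq; apply/sP; exists y.
  by congr (red _); apply: val_inj; rewrite /= Dy Dx.
have pK : [pchar K] =i pred0.
  by move=> c; rewrite (fmorph_pchar (in_alg K)) pchar_num.
have [g gP] := exists_frobenius_ext pK pk red_base.
exists v, g; split.
- suff -> : v = [set x | exists2 y : intring K, int_val y = x & redK y = 0].
    exact: (finite_prime_kernel redK (in_alg K)).
  apply/seteqP; split=> x; first exact: v_int.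
  by move=> [y <- ry]; apply/vE.
- rewrite -(rmorph_nat (@int_val K)); apply/vE.
  by rewrite rmorph_nat (pcharf0 pk).
- exists P.
    by split=> //; exact: (finite_prime_kernel red (iota \o in_alg K)).
  move=> x /lift_integer [y <-]; rewrite normE.
  have [y' Dy' ry'] := gP y; rewrite -Dy' -rmorphXn -rmorphB; apply/PE.
  by rewrite rmorphB rmorphXn ry' subrr.
- rewrite normE -szs; have s0 : 0 \in s by apply/sP; exists 0; rewrite rmorph0.
  have s1 : 1 \in s by apply/sP; exists 1; rewrite rmorph1.
  apply: (@uniq_leq_size _ [:: 0; 1]) => [|c].
    by rewrite /= inE eq_sym oner_eq0.
  by rewrite !inE => /orP [] /eqP ->.
Qed.

End PrimeFromResidue.

(** Otherwise [T] would contain a prime over every prime number. By Bezout a prime [v] contains at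
    most one prime number, so a prime number larger than those attached to the members of [T] gives
    a contradiction. *)
Lemma exists_frobenius (K : fieldExtType rat) (Kbar : algClosure K)
    (T : set (set K)) : finite_set T ->
  exists (v : set K) (g : absgal Kbar),
    [/\ finite_prime v, ~ T v, frobenius v g & (1 < prime_norm v)%N].
Proof.
move=> Tfin; apply: contrapT => none.
have prime_case (p : nat) : prime p -> exists2 v, T v &
    finite_prime v /\ v p%:R.
  move=> p_pr; have [k [red redp]] := exists_residue_field
    (prime_not_unit_integers (ac_emb Kbar \o in_alg K) p_pr).
  have pk : p \in [pchar k] by rewrite inE p_pr -(rmorph_nat red) redp eqxx.
  have [v [g [vp vpp frob vgt1]]] := exists_frobenius_residue red pk.
  exists v => //; apply: contrapT => nTv; apply: none.
  by exists v, g.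
have boundP (v : set K) : exists n : nat, forall p : nat, prime p ->
    finite_prime v -> v p%:R -> (p <= n)%N.
  have [[q [q_pr [vp vq]]]|nq] := pselect (exists q : nat,
      prime q /\ finite_prime v /\ v q%:R); last first.
    by exists 0%N => p p_pr vp vpp; case: nq; exists p.
  exists q => p p_pr _ vpp; have [->//|pq] := eqVneq p q.
  case: (fp_proper vp).
  have [a b Dab _] := egcdnP q (prime_gt0 p_pr).
  have nat_int (c : nat) : integers K c%:R.
    by rewrite -(rmorph_nat (@int_val K)); exact: int_val_integers.
  have copq : gcdn p q = 1%N.
    by apply/eqP; rewrite -/(coprime p q) prime_coprime // dvdn_prime2.
  have -> : 1 = a%:R * p%:R + (-1) * (b%:R * q%:R) :> K.
    by rewrite -!natrM Dab copq natrD mulN1r addrAC subrr add0r.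
  apply: (fp_add vp); first exact: (fp_mul vp).
  apply: (fp_mul vp); first by apply: integral_opp; exact: (nat_int 1).
  exact: (fp_mul vp).
have [nb nbP] := choice boundP.
have [t Dt] := (finite_seqP T).1 Tfin.
have [p p_gt p_pr] := prime_above (\max_(v <- t) nb v).
have [v Tv [vp vpp]] := prime_case p p_pr.
have := nbP v p p_pr vp vpp; rewrite leqNgt => /negP; apply.
apply: leq_ltn_trans p_gt; apply: leq_bigmax_seq => //.
by move: Tv; rewrite Dt.
Qed.

(** * Frobenius weights and homotheties *)

Section Annihilated.
Variable L : fieldType.
Implicit Types (u v : nat -> L) (s t : seq L) (a b c : L).

Definition shift_sub (a : L) (u : nat -> L) : nat -> L :=
  fun k => u k.+1 - a * u k.

(* [u] is annihilated by the product of the [S - a], for [a] in [s], where [S]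
   is the shift of sequences. *)
Fixpoint annihilated (s : seq L) (u : nat -> L) : Prop :=
  if s is a :: s' then annihilated s' (shift_sub a u) else forall k, u k = 0.

Lemma annihilated_ext s u v : u =1 v -> annihilated s u -> annihilated s v.
Proof. by move=> /funext ->. Qed.

Lemma annihilated_lin s u v c : annihilated s u -> annihilated s v ->
  annihilated s (fun k => c * u k + v k).
Proof.
elim: s u v => [|a s IH] u v /=.
  by move=> u0 v0 k; rewrite u0 v0 mulr0 addr0.
move=> su sv; apply: annihilated_ext (IH _ _ su sv) => k.
by rewrite /shift_sub; ring.
Qed.

Lemma annihilated0 s : annihilated s (fun=> 0).
Proof.
elim: s => //= a s; apply: annihilated_ext => k.
by rewrite /shift_sub mulr0 subrr.
Qed.

Lemma annihilatedZ s u c : annihilated s u -> annihilated s (fun k => c * u k).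
Proof.
move=> su; apply: annihilated_ext (annihilated_lin c su (annihilated0 s)) => k.
by rewrite addr0.
Qed.

Lemma annihilated_shift s u : annihilated s u -> annihilated s (fun k => u k.+1).
Proof. by elim: s u => [|a s IH] u /= => [u0 k|/IH]. Qed.

Lemma annihilated_shift_sub s u a :
  annihilated s u -> annihilated s (shift_sub a u).
Proof.
move=> su; have := annihilated_lin (- a) su (annihilated_shift su).
by apply: annihilated_ext => k; rewrite /shift_sub; ring.
Qed.

Lemma annihilated_catr s t u : annihilated s u -> annihilated (t ++ s) u.
Proof.
by elim: t u => //= a t IH u su; apply: IH; exact: annihilated_shift_sub.
Qed.

Lemma annihilated_catl s t u : annihilated s u -> annihilated (s ++ t) u.
Proof.
elim: s u => [|a s IH] u /=; last exact: IH.
by move=> u0; apply: annihilated_ext (annihilated0 t) => k; rewrite u0.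
Qed.

(** Induction on the total length: if [a] and [b] head the two lists, then [S - a] and [S - b] both
    kill [u], and the difference of these operators is the nonzero scalar [b - a]. *)
Lemma annihilated_disjoint s t u : (forall a, a \in s -> a \notin t) ->
  annihilated s u -> annihilated t u -> forall k, u k = 0.
Proof.
have [n] := ubnP (size s + size t); elim: n s t u => // n IH s t u.
case: s => // a s; case: t => // b t szst dis su tu k.
have a_b : a != b by have := dis a (mem_head _ _); rewrite inE negb_or => /andP [].
have ua j : shift_sub a u j = 0.
  apply: (IH s (b :: t) _ _ _ su (@annihilated_shift_sub (b :: t) u a tu)).
    by move: szst; rewrite /= addSn ltnS.
  by move=> c cs; apply: dis; rewrite inE cs orbT.
have ub j : shift_sub b u j = 0.
  apply: (IH (a :: s) t _ _ _ (@annihilated_shift_sub (a :: s) u b su) tu).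
    by move: szst; rewrite /= addnS ltnS.
  by move=> c cs; have := dis c cs; rewrite inE negb_or => /andP [].
have : (a - b) * u k = shift_sub b u k - shift_sub a u k.
  by rewrite /shift_sub; ring.
rewrite ua ub subrr.
by move/eqP; rewrite mulf_eq0 subr_eq0 (negbTE a_b) => /eqP.
Qed.

(** This rests on [(S - a b)(u v) = (S - a)(u) S(v) + a u (S - b)(v)], where induction on the total
    length applies to both terms. *)
Lemma annihilatedM s t u v : annihilated s u -> annihilated t v ->
  exists2 r, annihilated r (fun k => u k * v k) &
    forall c, c \in r -> exists a b, [/\ a \in s, b \in t & c = a * b].
Proof.
have [n] := ubnP (size s + size t); elim: n s t u v => // n IH s t u v.
case: s => [|a s]; first by move=> _ u0 _; exists [::] => //= k; rewrite u0 mul0r.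
case: t => [|b t]; first by move=> _ _ v0; exists [::] => //= k; rewrite v0 mulr0.
move=> szst su tv.
have [||r1 r1P r1E] := IH s (b :: t) (shift_sub a u) (fun k => v k.+1) _ su.
- by move: szst; rewrite /= addSn ltnS.
- exact: (@annihilated_shift (b :: t) v tv).
have [|r2 r2P r2E] := IH (a :: s) t u (shift_sub b v) _ su tv.
  by move: szst; rewrite /= addnS ltnS.
exists (a * b :: (r1 ++ r2)).
  have := annihilated_lin a (annihilated_catr r1 r2P) (annihilated_catl r2 r1P).
  by apply: annihilated_ext => k; rewrite /shift_sub; ring.
move=> c; rewrite inE mem_cat => /or3P [/eqP ->|/r1E|/r2E].
- by exists a, b; rewrite !inE !eqxx.
- by move=> [x [y [xs yt ->]]]; exists x, y; rewrite inE xs orbT.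
- by move=> [x [y [xs yt ->]]]; exists x, y; rewrite [y \in _]inE yt orbT.
Qed.

(** Applying [shift_sub a] to the entries of [F ^+ k *m M] amounts to replacing [M] by
    [(F - a) *m M]. For [M = 1] and [s] the eigenvalues, the hypothesis is the Cayley-Hamilton
    theorem. *)
Lemma annihilated_mulmx (N : nat) (F : 'M[L]_N.+1) s (M : 'M[L]_N.+1) i j :
  horner_mx F (\prod_(a <- s) ('X - a%:P)) *m M = 0 ->
  annihilated s (fun k => (F ^+ k *m M) i j).
Proof.
elim: s M => [|a s IH] M.
  rewrite big_nil rmorph1 mul1mx => -> k.
  by rewrite mulmx0 mxE.
rewrite big_cons mulrC rmorphM rmorphB /= horner_mx_X horner_mx_C -mulmxA => /IH.
apply: annihilated_ext => k; rewrite /shift_sub exprSr.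
rewrite mulmxA mulmxBr mul_mx_scalar mulmxBl -scalemxAl !mxE //.
Qed.

End Annihilated.

(** An induction on polynomial functions rather than on polynomials: monomials and the indexing by
    [mxvec] are dealt with once. *)
Lemma mx_eval_ind (F : fieldType) (N : nat) (P : ('M[F]_N -> F) -> Prop) :
    (forall c, P (fun=> c)) -> (forall i j, P (fun A => A i j)) ->
    (forall f g, P f -> P g -> P (fun A => f A + g A)) ->
    (forall f g, P f -> P g -> P (fun A => f A * g A)) ->
  forall p : {mpoly F[N * N]}, P (mx_eval p).
Proof.
move=> PC PX PD PM p.
have Pext f g : f =1 g -> P f -> P g by move=> /funext ->.
elim/mpolyind: p => [|c m p _ _ IH].
  by apply: Pext (PC 0) => A; rewrite /mx_eval meval0.
suff Pm : P (mx_eval 'X_[m]).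
  apply: Pext (PD _ _ (PM _ _ (PC c) Pm) IH) => A.
  by rewrite /mx_eval mevalD mevalZ.
suff Pr r : P (fun A => \prod_(i <- r) mxvec A 0 i ^+ m i).
  by apply: Pext (Pr (index_enum _)) => A; rewrite /mx_eval mevalX.
elim: r => [|i r IHr]; first by apply: Pext (PC 1) => A; rewrite big_nil.
have Pi : P (fun A => mxvec A 0 i).
  by case/mxvec_indexP: i => a b; apply: Pext (PX a b) => A; rewrite mxvecE.
suff Pe e : P (fun A => mxvec A 0 i ^+ e).
  by apply: Pext (PM _ _ (Pe (m i)) IHr) => A; rewrite big_cons.
elim: e => [|e IHe]; first by apply: Pext (PC 1) => A; rewrite expr0.
by apply: Pext (PM _ _ Pi IHe) => A; rewrite exprS.
Qed.

(* [p(t F^k)] is a polynomial in [t] whose [d]-th coefficient is annihilated,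
   as a function of [k], by a polynomial with roots in [A d].  When the [A d]
   are disjoint, the coefficients vanish separately as soon as
   [p(F^k) = 0] for all [k], and [k = 0] gives the result. *)
Section Homotheties.
Variables (L : closedFieldType) (N : nat) (F : 'M[L]_N) (A : nat -> set L).
Hypothesis A1 : A 0 1.
Hypothesis AM : forall d e a b, A d a -> A e b -> A (d + e)%N (a * b).
Hypothesis A_disj : forall d e a, A d a -> A e a -> d = e.
Hypothesis A_eig : forall a, eigenvalue F a -> A 1 a.

Let rec_in (d : nat) (u : nat -> L) :=
  exists2 s, annihilated s u & forall a, a \in s -> A d a.

Let rec_in0 d : rec_in d (fun=> 0).
Proof. by exists [::]. Qed.

Let rec_inD d u v : rec_in d u -> rec_in d v -> rec_in d (fun k => u k + v k).
Proof.
move=> [s su sA] [t tv tA]; exists (s ++ t).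
  have := annihilated_lin 1 (annihilated_catl t su) (annihilated_catr s tv).
  by apply: annihilated_ext => k; rewrite mul1r.
by move=> a; rewrite mem_cat => /orP [/sA|/tA].
Qed.

Let rec_inM d e u v :
  rec_in d u -> rec_in e v -> rec_in (d + e) (fun k => u k * v k).
Proof.
move=> [s su sA] [t tv tA]; have [r ruv rE] := annihilatedM su tv.
exists r => // _ /rE [a [b [ain bin ->]]]; apply: AM; [exact: sA|exact: tA].
Qed.

(** The size bound is uniform in [k], so that the equation [(f k).[1] = 0] is a sum over a fixed
    range of degrees. *)
Let graded (f : nat -> {poly L}) :=
  (exists D, forall k, (size (f k) <= D)%N) /\
  forall d, rec_in d (fun k => (f k)`_d).

(** Iterated products allow [N = 0]; [entry_rec] turns them into ring powers once an index shows
    that the size is positive. *)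
Let pow (k : nat) : 'M[L]_N := iter k (mulmx F) 1%:M.

Let entry_rec i j : rec_in 1 (fun k => pow k i j).
Proof.
rewrite /pow; case: (N) F A_eig i j => [|n] F' eigF i j; first by case: i.
have [s Ds] := closed_field_poly_normal (char_poly F').
rewrite (monicP (char_poly_monic F')) scale1r in Ds.
exists s; last first.
  by move=> a ain; apply: eigF; rewrite eigenvalue_root_char Ds root_prod_XsubC.
have := @annihilated_mulmx L n F' s 1%:M i j.
rewrite -Ds Cayley_Hamilton mul0mx => /(_ erefl).
apply: annihilated_ext => k; rewrite mulmx1; congr (fun_of_matrix _ i j).
by elim: k => //= k <-; rewrite exprS.
Qed.

Let graded_eval (p : {mpoly L[N * N]}) : exists f, graded f /\
  forall k t, mx_eval p (t *: pow k) = (f k).[t].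
Proof.
apply: (mx_eval_ind (P := fun q => exists f, graded f /\
  forall k t, q (t *: pow k) = (f k).[t]) _ _ _ _ p).
- move=> c; exists (fun=> c%:P); split; last by move=> k t; rewrite hornerC.
  split; first by exists 1%N => k; rewrite size_polyC leq_b1.
  case=> [|d]; last by exists [::] => //= k; rewrite coefC.
  exists [:: 1]; last by move=> a; rewrite inE => /eqP ->.
  by move=> k /=; rewrite /shift_sub mul1r subrr.
- move=> i j; exists (fun k => (pow k i j) *: 'X); split; last first.
    by move=> k t; rewrite hornerZ hornerX mxE mulrC.
  split.
    by exists 2 => k; rewrite (leq_trans (size_scale_leq _ _)) ?size_polyX.
  move=> d; have [->|d1] := eqVneq d 1%N.
    have [s su sA] := entry_rec i j; exists s => //.
    by apply: annihilated_ext su => k; rewrite coefZ coefX mulr1.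
  by exists [::] => //= k; rewrite coefZ coefX (negbTE d1) mulr0.
- move=> q r [f [[[D fD] fr] fE]] [g [[[D' gD] gr] gE]].
  exists (fun k => f k + g k); split; last by move=> k t; rewrite hornerD fE gE.
  split.
    exists (maxn D D') => k; rewrite (leq_trans (size_polyD _ _)) //.
    by rewrite geq_max !leq_max fD gD orbT.
  move=> d; have [s su sA] := rec_inD (fr d) (gr d); exists s => //.
  by apply: annihilated_ext su => k; rewrite coefD.
- move=> q r [f [[[D fD] fr] fE]] [g [[[D' gD] gr] gE]].
  exists (fun k => f k * g k); split; last by move=> k t; rewrite hornerM fE gE.
  split.
    exists (D + D')%N => k; rewrite (leq_trans (size_polyMleq _ _)) //.
    by rewrite (leq_trans (leq_pred _)) // leq_add.
  move=> d.
  have [s su sA] : rec_in d (fun k => \sum_(i < d.+1) (f k)`_i * (g k)`_(d - i)).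
    elim: (index_enum _) => [|i r' [s su sA]].
      by exists [::] => //= k; rewrite big_nil.
    have fg : rec_in d (fun k => (f k)`_i * (g k)`_(d - i)).
      have := rec_inM (fr i) (gr (d - i)%N).
      by rewrite subnKC // -ltnS.
    have [s' su' sA'] := rec_inD fg (ex_intro2 _ _ s su sA).
    by exists s' => //; apply: annihilated_ext su' => k; rewrite big_cons.
  by exists s => //; apply: annihilated_ext su => k; rewrite coefM.
Qed.

(** The last term is the opposite of the sum of the others, whose characteristic roots lie in the
    [A d] with [d < D]. These are disjoint from [A D], so the last term vanishes and induction
    applies. *)
Let rec_in_sum D (u : nat -> nat -> L) : (forall d, rec_in d (u d)) ->
  (forall k, \sum_(d < D) u d k = 0) -> forall d k, (d < D)%N -> u d k = 0.
Proof.
move=> ur; elim: D => // D IH sum0.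
have uD k : u D k = 0.
  have [s su sA] := ur D.
  have [t tu tA] : exists2 t, annihilated t (fun k => \sum_(d < D) u d k) &
      forall a, a \in t -> exists2 d, (d < D)%N & A d a.
    elim: (D) => [|E [t tu tA]]; first by exists [::] => //= k'; rewrite big_ord0.
    have [s' su' sA'] := ur E; exists (t ++ s').
      have := annihilated_lin 1 (annihilated_catl s' tu) (annihilated_catr t su').
      by apply: annihilated_ext => k'; rewrite mul1r big_ord_recr.
    move=> a; rewrite mem_cat => /orP [/tA [d dE Ad]|/sA' AE]; last by exists E.
    by exists d => //; rewrite ltnS ltnW.
  apply: (annihilated_disjoint (s := s) (t := t)) su _ k.
    move=> a /sA AD; apply/negP => /tA [d dD /(A_disj AD) Dd].
    by rewrite Dd ltnn in dD.
  apply: annihilated_ext (annihilatedZ (-1) tu) => k'.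
  have := sum0 k'; rewrite big_ord_recr /= => /eqP.
  by rewrite addr_eq0 => /eqP ->; rewrite mulN1r opprK.
move=> d k; rewrite ltnS leq_eqVlt => /orP [/eqP -> //|].
apply: IH => k'; have := sum0 k'.
by rewrite big_ord_recr /= uD addr0.
Qed.

Lemma vanish_on_homotheties (p : {mpoly L[N * N]}) :
  (forall k, mx_eval p (iter k (mulmx F) 1%:M) = 0) ->
  forall t, mx_eval p t%:M = 0.
Proof.
move=> p0 t; have [f [[[D fD] fr] fE]] := graded_eval p.
have fk0 d k : (f k)`_d = 0.
  have [dD|Dd] := ltnP d D; last by rewrite nth_default // (leq_trans (fD k)).
  apply: (rec_in_sum fr (D := D)) => // k'.
  have := p0 k'; rewrite -[iter _ _ _]scale1r fE (horner_coef_wide _ (fD k')).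
  by under eq_bigr do rewrite expr1n mulr1.
rewrite -[t%:M]scalemx1 -[1%:M]/(pow 0) fE.
have -> : f 0%N = 0 by apply/polyP => d; rewrite fk0 coef0.
by rewrite horner0.
Qed.

End Homotheties.

(** The eigenvalues lie in a field generated by one [z], which is embedded in the complex numbers by
    sending [z] to a conjugate [zeta]. The set [A d] consists of the elements whose image has
    absolute value [r ^+ d]; these sets are disjoint because [r] is positive and not [1]. *)
Lemma homotheties_of_weight (R : realType) (L : closedFieldType)
    (i : {rmorphism rat -> L}) (N : nat) (F : 'M[L]_N) (r : R[i])
    (p : {mpoly L[N * N]}) : 0 < r -> r != 1 ->
    (forall x, eigenvalue F x -> complex_abs_is i x r) ->
    (forall k, mx_eval p (iter k (mulmx F) 1%:M) = 0) ->
  forall t, mx_eval p t%:M = 0.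
Proof.
move=> r_gt0 r_neq1 Fr.
have [s Ds] := closed_field_poly_normal (char_poly F).
rewrite (monicP (char_poly_monic F)) scale1r in Ds.
have eigE x : eigenvalue F x = (x \in s).
  by rewrite eigenvalue_root_char Ds root_prod_XsubC.
have ratc : [pchar rat] =i pred0 by exact: pchar_num.
have [z algz zs] : exists2 z, algebraicOver i z &
    forall x, x \in s -> exists h : {poly rat}, (map_poly i h).[z] = x.
  apply: primitive_element ratc _ => x; rewrite -eigE => /Fr [q [[q1 _] qx _]].
  by exists q => //; rewrite -size_poly_gt0 ltnW.
have [m [m1 mz m_dvd]] := annihilator_generator algz.
have [zeta mzeta] : exists zeta : R[i], root (map_poly ratr m) zeta.
  apply/closed_rootP; rewrite size_map_poly; apply: contraTneq mz => szm.
  have [c c0 Dm] := size_poly1P m (introT eqP szm).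
  by rewrite Dm map_polyC rootC fmorph_eq0.
have transfer h : root (map_poly i h) z -> root (map_poly ratr h) zeta.
  by move=> /m_dvd /dvdpP [u ->]; rewrite rmorphM rootM mzeta orbT.
pose A (d : nat) := [set x | exists2 h : {poly rat}, (map_poly i h).[z] = x &
  `|(map_poly ratr h).[zeta]| = r ^+ d].
apply: (vanish_on_homotheties (A := A)).
- by exists 1; rewrite rmorph1 hornerC ?normr1.
- move=> d e _ _ [h <- hd] [k <- ke]; exists (h * k).
    by rewrite rmorphM hornerM.
  by rewrite rmorphM hornerM normrM hd ke exprD.
- move=> d e _ [h <- hd] [k kz ke].
  have : root (map_poly ratr (h - k)) zeta.
    by apply: transfer; rewrite /root rmorphB hornerD hornerN kz subrr.
  rewrite /root rmorphB hornerD hornerN subr_eq0 => /eqP hk.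
  by apply: (ieexprIn r_gt0 r_neq1); rewrite -hd -ke hk.
- move=> x xF; have [q [_ qx qr]] := Fr _ xF; rewrite eigE in xF.
  have [h hx] := zs _ xF; exists h => //; rewrite expr1; apply: qr.
  rewrite /root -horner_comp -map_comp_poly; apply: transfer.
  by rewrite /root map_comp_poly horner_comp hx.
Qed.

Lemma weight_abs_neq1 (R : realType) (q : nat) (n : int) : (1 < q)%N -> n != 0 ->
  0 < sqrtC (q%:R : R[i]) ^ n /\ sqrtC (q%:R : R[i]) ^ n != 1.
Proof.
move=> q1 n0; have q_gt0 : 0 < sqrtC (q%:R : R[i]).
  by rewrite sqrtC_gt0 ltr0n ltnW.
split; first exact: exprz_gt0.
rewrite pexprz_eq1 ?ltW // (negbTE n0) /=; apply: contraTneq q1 => s1.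
have /eqP := sqrtCK (q%:R : R[i]); rewrite s1 expr1n eq_sym pnatr_eq1.
by move=> /eqP ->.
Qed.

(** * The Zariski topology on matrices *)

Section Hull.
Variables (F : fieldType) (N : nat).
Implicit Types (S G : set 'M[F]_N) (p : {mpoly F[N * N]}).

(** The Zariski closure of [S] in the space of all matrices. *)
Definition hull (S : set 'M[F]_N) : set 'M[F]_N :=
  [set A | forall p, (forall B, S B -> mx_eval p B = 0) -> mx_eval p A = 0].

Definition closed_in (G B : set 'M[F]_N) : Prop :=
  B `<=` G /\ G `&` hull B `<=` B.

Definition polymap (phi : 'M[F]_N -> 'M[F]_N) : Prop :=
  forall p, exists q, forall A, mx_eval q A = mx_eval p (phi A).

Lemma sub_hull S : S `<=` hull S.
Proof. by move=> A SA p; apply. Qed.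

Lemma hullS S S' : S `<=` S' -> hull S `<=` hull S'.
Proof. by move=> sub A hA p p0; apply: hA => B /sub; exact: p0. Qed.

Lemma hull_hull S : hull (hull S) `<=` hull S.
Proof. by move=> A hA p p0; apply: hA => B; apply. Qed.

Lemma hullU S S' : hull (S `|` S') `<=` hull S `|` hull S'.
Proof.
move=> A hA; apply: contrapT => /not_orP [].
move=> /existsNP [p /not_implyP [pS pA]] /existsNP [q /not_implyP [qS qA]].
have /eqP : mx_eval (p * q) A = 0.
  apply: hA => B [/pS|/qS]; rewrite /mx_eval mevalM => ->.
    by rewrite mul0r.
  by rewrite mulr0.
by rewrite /mx_eval mevalM mulf_eq0 => /orP [] /eqP.
Qed.

Lemma hull_bigcup (I : finType) (S : I -> set 'M[F]_N) A :
  hull [set B | exists i, S i B] A -> exists i, hull (S i) A.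
Proof.
move=> hA; suff H (r : seq I) : hull [set B | exists2 i, i \in r & S i B] A ->
    exists i, hull (S i) A.
  apply: (H (enum I)); apply: hullS hA => B [i SB].
  by exists i; rewrite ?mem_enum.
elim: r => [|i r IH] {}hA.
  have /eqP : mx_eval (1 : {mpoly F[N * N]}) A = 0 by apply: hA => B [].
  by rewrite /mx_eval meval1 oner_eq0.
have : hull (S i `|` [set B | exists2 i, i \in r & S i B]) A.
  apply: hullS hA => B [k]; rewrite inE => /predU1P [->|kr] SB; first by left.
  by right; exists k.
by move=> /hullU [|/IH //]; exists i.
Qed.

Lemma hull_polymap phi S A : polymap phi ->
  hull S A -> hull (phi @` S) (phi A).
Proof.
move=> phiP hA p p0; have [q qE] := phiP p; rewrite -qE; apply: hA => B SB.
by rewrite qE; apply: p0; exists B.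
Qed.

Lemma zariski_closedP (C : set (zariski F N)) :
  closed C <-> exists I, C = zlocus I.
Proof.
rewrite -[C in closed C]setCK closedC; split=> [[I /(congr1 (@setC _))]|[I ->]].
  by rewrite !setCK; exists I.
by exists I.
Qed.

Lemma closed_inP G B :
  closed_in G B <-> exists2 C : set (zariski F N), closed C & B = G `&` C.
Proof.
split=> [[BG hB]|[_ /zariski_closedP [I ->] ->]].
  exists (zlocus [set p | forall A, B A -> mx_eval p A = 0]).
    by apply/zariski_closedP; eexists.
  apply/seteqP; split=> A; first by move=> BA; split; [exact: BG|move=> p; apply].
  by move=> [GA hA]; apply: hB.
split=> [A []//|A [GA hA]]; split=> // p Ip; apply: hA => B' [_]; exact.
Qed.

(** Openness of [B] in [G] is expressed by closedness of its complement, so that connectedness can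
    be tested with [hull] alone. *)
Lemma zconnectedP G : @connected (zariski F N) G <-> forall B, B !=set0 ->
  closed_in G B -> closed_in G (G `\` B) -> B = G.
Proof.
have opE B : B `<=` G -> closed_in G (G `\` B) <->
    exists2 U : set (zariski F N), open U & B = G `&` U.
  move=> BG; rewrite closed_inP; split=> [[C Ccl DC]|[U Uop DB]].
    exists (~` C); first by rewrite openC.
    apply/seteqP; split=> A.
      move=> BA; split; first exact: BG.
      by move=> CA; have [] : (G `\` B) A by rewrite DC; split=> //; exact: BG.
    move=> [GA nCA]; apply: contrapT => nBA; apply: nCA.
    by have [] : (G `&` C) A by rewrite -DC.
  exists (~` U); first by rewrite closedC.
  apply/seteqP; split=> A [GA]; rewrite DB.
    by move=> nBA; split=> // UA; apply: nBA.
  by move=> nUA; split=> // -[].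
split=> conn B B0.
  move=> Bcl Bop; have BG := Bcl.1; apply: conn => //; first exact/opE.
  exact/closed_inP.
move=> Uop Ccl; have BG : B `<=` G by case: Uop => U _ -> A [].
by apply: conn => //; [exact/closed_inP|exact/opE].
Qed.

Lemma closed_in_setI G H B : closed_in G B -> closed_in (G `&` H) (B `&` H).
Proof.
move=> [BG hB]; split=> [A [/BG GA HA]//|A [[GA HA] hA]]; split=> //.
by apply: hB; split=> //; apply: hullS hA => A' [].
Qed.

Lemma closed_in_setU G B B' :
  closed_in G B -> closed_in G B' -> closed_in G (B `|` B').
Proof.
move=> [BG hB] [BG' hB']; split=> [A [/BG|/BG']//|A [GA /hullU [hA|hA]]].
  by left; exact: hB.
by right; exact: hB'.
Qed.

Lemma closed_in_preimage G B phi : polymap phi -> closed_in (phi @` G) B ->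
  closed_in G (G `&` phi @^-1` B).
Proof.
move=> phiP [BG hB]; split=> [A []//|A [GA hA]]; split=> //; apply: hB.
split; first by exists A.
apply: hullS (hull_polymap phiP hA) => _ [A' [_ /= BA'] <-] //.
Qed.

Lemma zconnected_image G phi : polymap phi ->
  @connected (zariski F N) G -> @connected (zariski F N) (phi @` G).
Proof.
move=> phiP /zconnectedP conn; apply/zconnectedP => B [M BM] Bcl Bop.
have [A GA DA] := Bcl.1 _ BM; rewrite -{}DA in BM.
have := conn (G `&` phi @^-1` B); have -> : G `\` (G `&` phi @^-1` B) =
    G `&` phi @^-1` (phi @` G `\` B).
  apply/seteqP; split=> A' [GA' nB]; split=> //.
    by split; [exists A'|move=> BA'; apply: nB].
  by move=> [_ BA']; case: nB.
move=> /(_ _ (closed_in_preimage phiP Bcl) (closed_in_preimage phiP Bop)) DG.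
apply/seteqP; split; first exact: Bcl.1.
by move=> _ [A' GA' <-]; move: GA'; rewrite -DG => [[]|]; last by exists A.
Qed.

Lemma zconnected_hull G B : B `<=` G ->
  @connected (zariski F N) B -> @connected (zariski F N) (G `&` hull B).
Proof.
move=> BG /zconnectedP conn; apply/zconnectedP => Y [A YA] Ycl Yop.
have sub : B `<=` G `&` hull B.
  by move=> A' BA'; split; [exact: BG|exact: sub_hull].
have DB : (G `&` hull B) `&` B = B by apply/setIidr.
have YBcl := closed_in_setI B Ycl; have YBop := closed_in_setI B Yop.
rewrite DB in YBcl YBop.
have DBY : ((G `&` hull B) `\` Y) `&` B = B `\` (Y `&` B).
  apply/seteqP; split=> A' [].
    by move=> [_ nY] BA'; split=> // -[].
  by move=> BA' nY; split=> //; split; [exact: sub|move=> YA'; exact: nY].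
rewrite DBY in YBop.
have [YB0|/set0P YB0] := eqVneq (Y `&` B) set0.
  (* As [Y] does not meet [B], the complement of [Y] contains [B]; being closed, it also contains
     [A], a contradiction. *)
  have : ((G `&` hull B) `\` Y) A.
    apply: Yop.2; split; first exact: Ycl.1.
    have [GA hA] := Ycl.1 _ YA; apply: hullS hA => A' BA'; split; first exact: sub.
    by move=> YA'; have : (Y `&` B) A' by []; rewrite YB0.
  by case.
have DY := conn _ YB0 YBcl YBop.
apply/seteqP; split; first exact: Ycl.1.
move=> A' [GA' hA']; apply: Ycl.2; split=> //.
by apply: hullS hA'; rewrite -DY => ? [].
Qed.

Definition polyfun (f : 'M[F]_N -> F) : Prop :=
  exists q : {mpoly F[N * N]}, forall A, mx_eval q A = f A.

Lemma polyfun_cst c : polyfun (fun=> c).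
Proof. by exists c%:MP => A; rewrite /mx_eval mevalC. Qed.

Lemma polyfun_entry i j : polyfun (fun A => A i j).
Proof. by exists 'X_(mxvec_index i j) => A; rewrite /mx_eval mevalXU mxvecE. Qed.

Lemma polyfunD f g : polyfun f -> polyfun g -> polyfun (fun A => f A + g A).
Proof.
by move=> [q qE] [r rE]; exists (q + r) => A; rewrite -qE -rE /mx_eval mevalD.
Qed.

Lemma polyfunM f g : polyfun f -> polyfun g -> polyfun (fun A => f A * g A).
Proof.
by move=> [q qE] [r rE]; exists (q * r) => A; rewrite -qE -rE /mx_eval mevalM.
Qed.

Lemma polyfun_sum (I : finType) (f : I -> 'M[F]_N -> F) :
  (forall i, polyfun (f i)) -> polyfun (fun A => \sum_i f i A).
Proof.
move=> /choice [q qE]; exists (\sum_i q i) => A.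
by rewrite /mx_eval raddf_sum; apply: eq_bigr => i _; exact: qE.
Qed.

Lemma polyfun_prod (I : finType) (f : I -> 'M[F]_N -> F) :
  (forall i, polyfun (f i)) -> polyfun (fun A => \prod_i f i A).
Proof.
move=> /choice [q qE]; exists (\prod_i q i) => A.
by rewrite /mx_eval rmorph_prod; apply: eq_bigr => i _; exact: qE.
Qed.

Lemma polyfunX f m : polyfun f -> polyfun (fun A => f A ^+ m).
Proof.
by move=> [q qE]; exists (q ^+ m) => A; rewrite -qE /mx_eval rmorphXn.
Qed.

Lemma polyfun_det m (B : 'M[F]_N -> 'M[F]_m) :
  (forall i j, polyfun (fun A => B A i j)) -> polyfun (fun A => \det (B A)).
Proof.
move=> BP; apply: polyfun_sum => s; apply: polyfunM; first exact: polyfun_cst.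
by apply: polyfun_prod => i; exact: BP.
Qed.

Lemma polyfun_adj i j : polyfun (fun A => \adj A i j).
Proof.
have [q qE] : polyfun (fun A => cofactor A j i).
  apply: polyfunM; first exact: polyfun_cst.
  apply: polyfun_det => a b; have [q qE] := polyfun_entry (lift j a) (lift i b).
  by exists q => A; rewrite qE !mxE.
by exists q => A; rewrite qE mxE.
Qed.

Lemma polymap_entries (phi : 'M[F]_N -> 'M[F]_N) :
  (forall i j, polyfun (fun A => phi A i j)) ->
  polymap phi.
Proof.
move=> phiP p; apply: (mx_eval_ind (P := fun f => polyfun (fun A => f (phi A)))
  _ _ _ _ p) => [c|//|f g|f g].
- exact: polyfun_cst.
- exact: polyfunD.
- exact: polyfunM.
Qed.

Lemma polymap_mull M : polymap (mulmx M).
Proof.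
apply: polymap_entries => i j.
have [q qE] : polyfun (fun A => \sum_k M i k * A k j).
  apply: polyfun_sum => k; apply: polyfunM; first exact: polyfun_cst.
  exact: polyfun_entry.
by exists q => A; rewrite qE mxE.
Qed.

Lemma polymap_mulr M : polymap (mulmx^~ M).
Proof.
apply: polymap_entries => i j.
have [q qE] : polyfun (fun A => \sum_k A i k * M k j).
  apply: polyfun_sum => k; apply: polyfunM; last exact: polyfun_cst.
  exact: polyfun_entry.
by exists q => A; rewrite qE mxE.
Qed.

Lemma polymap_comp phi psi : polymap phi -> polymap psi -> polymap (phi \o psi).
Proof.
move=> phiP psiP p; have [q qE] := phiP p; have [r rE] := psiP q.
by exists r => A; rewrite rE qE.
Qed.

(** Inversion is not polynomial, but by Cramer's rule a power of the determinant clears all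
    denominators. *)
Lemma mx_eval_inv p : exists m (q : {mpoly F[N * N]}), forall A : 'M[F]_N,
  A \in unitmx -> mx_eval q A = \det A ^+ m * mx_eval p (invmx A).
Proof.
have det_poly : polyfun (fun A => \det A).
  by apply: polyfun_det => i j; exact: polyfun_entry.
suff [m [f [[q qE] fE]]] : exists m f, polyfun f /\ forall A : 'M[F]_N,
    A \in unitmx -> f A = \det A ^+ m * mx_eval p (invmx A).
  by exists m, q => A uA; rewrite qE fE.
apply: (mx_eval_ind (P := fun h => exists m f, polyfun f /\ forall A : 'M[F]_N,
    A \in unitmx -> f A = \det A ^+ m * h (invmx A)) _ _ _ _ p).
- by move=> c; exists 0%N, (fun=> c); split=> [|A _];
    [exact: polyfun_cst|rewrite mul1r].
- move=> i j; exists 1%N, (fun A => \adj A i j); split=> [|A uA].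
    exact: polyfun_adj.
  rewrite /invmx uA [in RHS]mxE expr1 mulrA divff ?mul1r //.
  by rewrite -unitfE -unitmxE.
- move=> h h' [m [f [fP fE]]] [m' [f' [f'P f'E]]].
  exists (m + m')%N, (fun A => \det A ^+ m' * f A + \det A ^+ m * f' A).
  split=> [|A uA]; last by rewrite fE // f'E // exprD; ring.
  by apply: polyfunD; apply: polyfunM => //; exact: polyfunX.
- move=> h h' [m [f [fP fE]]] [m' [f' [f'P f'E]]].
  exists (m + m')%N, (fun A => f A * f' A).
  split=> [|A uA]; last by rewrite fE // f'E // exprD; ring.
  exact: polyfunM.
Qed.

Lemma hull_inv S A : (forall B, S B -> B \in unitmx /\ S (invmx B)) ->
  A \in unitmx -> hull S A -> hull S (invmx A).
Proof.
move=> Sinv uA hA p p0; have [m [q qE]] := mx_eval_inv p.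
have /eqP : mx_eval q A = 0.
  by apply: hA => B /Sinv [uB SB]; rewrite qE // p0 // mulr0.
rewrite qE // mulf_eq0 expf_eq0; case/orP => [/andP [_]|/eqP //].
by move=> /eqP dA; move: uA; rewrite unitmxE dA unitr0.
Qed.

End Hull.

(** * Connected components *)

Record mxgroup (F : fieldType) (N : nat) (G : set 'M[F]_N) : Prop := {
  mxgroup1 : G 1%:M;
  mxgroupM : forall A B, G A -> G B -> G (A *m B);
  mxgroupV : forall A, G A -> A \in unitmx /\ G (invmx A)
}.

Section Components.
Variables (F : fieldType) (N : nat) (G : set 'M[F]_N).
Hypothesis gG : mxgroup G.
Let C := id_component G.
Local Notation zconnected := (@connected (zariski F N)).

Lemma id_component_sub : C `<=` G.
Proof. exact: (@connected_component_sub (zariski F N)). Qed.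

Lemma id_component1 : C 1%:M.
Proof.
by apply: (@connected_component_refl (zariski F N)); exact: (mxgroup1 gG).
Qed.

Lemma id_component_connected : zconnected C.
Proof. exact: (@component_connected (zariski F N)). Qed.

Lemma id_component_max B : B 1%:M -> B `<=` G -> zconnected B -> B `<=` C.
Proof. exact: (@connected_component_max (zariski F N) G B 1%:M). Qed.

(** The closure of [C] in [G] is connected and contains [1], so it is contained in [C]. *)
Lemma mxgroup_closed_id_component : closed_in G C.
Proof.
split; first exact: id_component_sub.
apply: id_component_max => [|A []//|].
  by split; [exact: (mxgroup1 gG)|apply: sub_hull; exact: id_component1].
by apply: zconnected_hull id_component_sub id_component_connected.
Qed.

Lemma mulKVmx_set (A : 'M[F]_N) (S : set 'M[F]_N) : A \in unitmx ->
  mulmx (invmx A) @` (mulmx A @` S) = S.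
Proof.
move=> uA; apply/seteqP; split=> [_ [_ [B SB <-] <-]|B SB].
  by rewrite mulKmx.
by exists (A *m B); [exists B|rewrite mulKmx].
Qed.

(** Left translations by elements of [G], and their inverses, are polynomial maps, so they permute
    the components. *)
Lemma zcomponent_coset A : G A -> zcomponent G A = mulmx A @` C.
Proof.
move=> GA; have [uA GV] := mxgroupV gG GA.
apply/seteqP; split.
  have sub : mulmx (invmx A) @` zcomponent G A `<=` C.
    apply: id_component_max.
    - exists A; last by rewrite mulVmx.
      exact: (@connected_component_refl (zariski F N)).
    - move=> _ [B /(@connected_component_sub (zariski F N)) GB <-].
      exact: (mxgroupM gG).
    - apply: zconnected_image; first exact: polymap_mull.
      exact: (@component_connected (zariski F N)).
  move=> B ZB; exists (invmx A *m B); last by rewrite mulKVmx.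
  by apply: sub; exists B.
apply: (@connected_component_max (zariski F N)).
- by exists 1%:M; [exact: id_component1|rewrite mulmx1].
- by move=> _ [B /id_component_sub GB <-]; exact: (mxgroupM gG).
- by apply: zconnected_image; [exact: polymap_mull|exact: id_component_connected].
Qed.

Lemma mxgroup_id_component : mxgroup C.
Proof.
have sub A : C A -> mulmx A @` C = C.
  move=> CA; rewrite -zcomponent_coset; last exact: id_component_sub.
  by apply/esym; exact: (@same_connected_component (zariski F N)).
split=> [|A B CA CB|A CA]; first exact: id_component1.
  by rewrite -(sub A CA); exists B.
have [uA _] := mxgroupV gG (id_component_sub CA); split=> //.
have : C 1%:M by exact: id_component1.
rewrite -{1}(sub A CA) => -[B CB AB].
by rewrite -[invmx A]mulmx1 -AB mulKmx.
Qed.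

Lemma id_component_conj A B : G A -> C B -> C (A *m B *m invmx A).
Proof.
move=> GA CB; have [uA GV] := mxgroupV gG GA.
have pm : polymap (mulmx^~ (invmx A) \o mulmx A).
  by apply: polymap_comp; [exact: polymap_mulr|exact: polymap_mull].
have sub : (mulmx^~ (invmx A) \o mulmx A) @` C `<=` C.
  apply: id_component_max => [|_ [B' /id_component_sub GB <-] /=|].
  - by exists 1%:M; [exact: id_component1|rewrite /= mulmx1 mulmxV].
  - by apply: (mxgroupM gG) => //; apply: (mxgroupM gG).
  - by apply: zconnected_image => //; exact: id_component_connected.
by apply: sub; exists B.
Qed.

Lemma coset_eq A B : G A -> G B -> C (invmx A *m B) ->
  mulmx A @` C = mulmx B @` C.
Proof.
move=> GA GB CAB; have [uA _] := mxgroupV gG GA.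
rewrite -!zcomponent_coset //; apply: (@same_connected_component (zariski F N)).
rewrite -/(zcomponent G A) zcomponent_coset //.
by exists (invmx A *m B) => //; rewrite mulKVmx.
Qed.

Lemma mulset_coset A B : G A -> G B ->
  mulset (mulmx A @` C) (mulmx B @` C) = mulmx (A *m B) @` C.
Proof.
move=> GA GB; have [uB GV] := mxgroupV gG GB; have gC := mxgroup_id_component.
apply/seteqP; split=> [_ [_ [c Cc <-] [_ [d Cd <-] <-]]|_ [d Cd <-]].
  exists (invmx B *m c *m B *m d).
    apply: (mxgroupM gC) => //; have := id_component_conj GV Cc.
    by rewrite invmxK.
  by rewrite !mulmxA mulmxK.
exists A; first by exists 1%:M; rewrite ?mulmx1 //; exact: id_component1.
by exists (B *m d); [exists d|rewrite mulmxA].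
Qed.

End Components.

Section Pi0.
Variables (F : fieldType) (N : nat) (G G1 : set 'M[F]_N).
Hypotheses (gG : mxgroup G) (gG1 : mxgroup G1) (G1G : G1 `<=` G).
Let C := id_component G.
Let C1 := id_component G1.
Let negC1 := mulset [set - 1%:M] C1.
Hypothesis opp1 : G1 (- 1%:M).
Hypothesis G1_cosets : forall A, G A -> exists2 B, G1 B & C (invmx A *m B).
Hypothesis G1C : G1 `&` C = C1 `|` negC1.

Let C1C : C1 `<=` C.
Proof.
apply: id_component_max.
- exact: id_component1.
- by move=> A /id_component_sub /G1G.
- exact: id_component_connected.
Qed.

Let negC1E : negC1 = mulmx (- 1%:M) @` C1.
Proof.
by apply/seteqP; split=> [_ [_ -> [c Cc <-]]|_ [c Cc <-]];
  [exists c|exists (- 1%:M) => //; exists c].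
Qed.

Let pi0_inclE A : G1 A -> pi0_incl G (mulmx A @` C1) = mulmx A @` C.
Proof.
move=> GA; apply/seteqP; split=> [B [_ [c Cc <-]]|B CB].
  have GAc : G (A *m c) by apply/G1G/(mxgroupM gG1) => //; exact: id_component_sub.
  rewrite (zcomponent_coset gG) // => -[d Cd <-]; exists (c *m d).
    by apply: (mxgroupM (mxgroup_id_component gG)) => //; exact: C1C.
  by rewrite mulmxA.
exists A; first by exists 1%:M; rewrite ?mulmx1 //; exact: (id_component1 gG1).
by rewrite (zcomponent_coset gG) //; exact: G1G.
Qed.

Lemma pi0_incl_epi : pi0_epi G1 G (pi0_incl G).
Proof.
split; first split.
- move=> _ [A GA <-]; rewrite (zcomponent_coset gG1) // pi0_inclE //.
  by exists A; [exact: G1G|rewrite (zcomponent_coset gG) //; exact: G1G].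
- move=> _ _ [A GA <-] [B GB <-]; rewrite !(zcomponent_coset gG1) //.
  rewrite (mulset_coset gG1) // !pi0_inclE //; last exact: (mxgroupM gG1).
  by rewrite (mulset_coset gG) //; exact: G1G.
- move=> _ [A GA <-]; have [B GB CAB] := G1_cosets GA.
  exists (zcomponent G1 B); first by exists B.
  rewrite (zcomponent_coset gG1) // pi0_inclE // (zcomponent_coset gG) //.
  by apply/esym/(coset_eq gG) => //; exact: G1G.
Qed.

(** The component of [A] in [G1] is in the kernel exactly when [A] lies in [C], and [G1C] lists such
    elements. *)
Lemma pi0_incl_ker : pi0_ker G1 G (pi0_incl G) = [set C1; negC1].
Proof.
have C1E : C1 = mulmx 1%:M @` C1.
  apply/seteqP; split=> [c Cc|_ [c Cc <-]]; last by rewrite mul1mx.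
  by exists c; rewrite ?mul1mx.
have kerE A : G1 A -> C A -> mulmx A @` C = C.
  move=> GA CA; rewrite -(zcomponent_coset gG); last exact: G1G.
  by apply/esym; exact: (@same_connected_component (zariski F N)).
have inker A : G1 A -> C A -> pi0_ker G1 G (pi0_incl G) (mulmx A @` C1).
  move=> GA CA; split; last by rewrite pi0_inclE // kerE.
  by exists A => //; rewrite (zcomponent_coset gG1).
apply/seteqP; split.
  move=> _ [[A GA <-]]; rewrite (zcomponent_coset gG1) // pi0_inclE // => DA.
  have CA : C A.
    by rewrite /C -DA; exists 1%:M; rewrite ?mulmx1 //; exact: (id_component1 gG).
  have : (G1 `&` C) A by [].
  rewrite G1C => -[C1A|]; first left.
    rewrite -(zcomponent_coset gG1) //.
    by apply/esym; exact: (@same_connected_component (zariski F N)).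
  rewrite {1}negC1E => -[c Cc Dc].
  suff DX : mulmx A @` C1 = negC1 by right.
  rewrite negC1E; apply/esym.
  apply: (coset_eq gG1) => //.
  suff -> : invmx (- 1%:M) *m A = c by [].
  by rewrite -Dc mulKmx // ; have [] := mxgroupV gG1 opp1.
have CN : C (- 1%:M).
  have : (C1 `|` negC1) (- 1%:M).
    right; rewrite negC1E; exists 1%:M; rewrite ?mulmx1 //.
    exact: (id_component1 gG1).
  by rewrite -G1C => -[].
move=> _ [->|->].
  rewrite C1E; apply: inker; first exact: (mxgroup1 gG1).
  exact: (id_component1 gG).
by rewrite negC1E; exact: inker.
Qed.

End Pi0.

Section Scalars.
Variables (F : closedFieldType) (N : nat).
Definition homotheties : set 'M[F]_N := [set t%:M | t in [set t | t != 0]].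

Lemma mx_eval_scalar (p : {mpoly F[N * N]}) :
  exists P : {poly F}, forall t, mx_eval p t%:M = P.[t].
Proof.
apply: (mx_eval_ind (P := fun f => exists P : {poly F}, forall t, f t%:M = P.[t])
  _ _ _ _ p) => [c|i j|f g|f g].
- by exists c%:P => t; rewrite hornerC.
- by exists ((i == j)%:R *: 'X) => t; rewrite hornerZ hornerX mxE mulr_natl.
- by move=> [P PE] [Q QE]; exists (P + Q) => t; rewrite hornerD PE QE.
- by move=> [P PE] [Q QE]; exists (P * Q) => t; rewrite hornerM PE QE.
Qed.

(** Equations of two complementary closed parts restrict to polynomials [P] and [Q] in the scalar
    [t] whose product vanishes for [t != 0]. The factor ['X] disposes of [t = 0]; over an
    algebraically closed field the product is then zero, hence so is [P] or [Q]. *)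
Lemma homotheties_connected : @connected (zariski F N) homotheties.
Proof.
apply/zconnectedP => B [A BA] Bcl Bop; have [t0 t00 DA] := Bcl.1 _ BA.
apply/seteqP; split; first exact: Bcl.1.
move=> _ [t1 t10 <-]; apply: contrapT => nB.
have SB : (homotheties `\` B) t1%:M by split=> //; exists t1.
have : ~ hull B t1%:M by move=> hB; apply: nB; apply: Bcl.2; split=> //; case: SB.
move=> /existsNP [p /not_implyP [pB p1]].
have : ~ hull (homotheties `\` B) A.
  by move=> hA; have [] := Bop.2 A (conj (Bcl.1 _ BA) hA).
move=> /existsNP [q /not_implyP [qB q0]].
have [P PE] := mx_eval_scalar p; have [Q QE] := mx_eval_scalar q.
have PQ0 : 'X * P * Q = 0.
  apply: contrapT => /eqP /closed_nonrootP [t]; rewrite /root !hornerM hornerX.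
  have [->|t_neq0] := eqVneq t 0; first by rewrite !mul0r eqxx.
  have [Bt|nBt] := pselect (B t%:M).
    by rewrite -PE pB // mulr0 mul0r eqxx.
  by rewrite -QE qB ?mulr0 ?eqxx //; split=> //; exists t.
move/eqP: PQ0; rewrite !mulf_eq0 polyX_eq0 /= => /orP [] /eqP P0.
  by apply: p1; rewrite PE P0 horner0.
by apply: q0; rewrite -DA QE P0 horner0.
Qed.

End Scalars.
Arguments homotheties F N : clear implicits.

(** * Isometries in a connected group of similitudes *)

Section Clopen.
Variables (F : fieldType) (N : nat).
Implicit Types X A B : set 'M[F]_N.

Definition clopen_in X B : Prop := closed_in X B /\ closed_in X (X `\` B).

Lemma closed_in_cap X A B :
  closed_in X A -> closed_in X B -> closed_in X (A `&` B).
Proof.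
move=> [AX hA] [BX hB]; split=> [M [/AX]//|M [XM hM]].
by split; [apply: hA|apply: hB]; split=> //; apply: hullS hM => ? [].
Qed.

Lemma clopen_inC X A : clopen_in X A -> clopen_in X (X `\` A).
Proof.
move=> [Acl Aop]; split=> //; rewrite setDD setIidr //; exact: Acl.1.
Qed.

Lemma clopen_inI X A B :
  clopen_in X A -> clopen_in X B -> clopen_in X (A `&` B).
Proof.
move=> [Acl Aop] [Bcl Bop]; split; first exact: closed_in_cap.
by rewrite setDIr; exact: closed_in_setU.
Qed.

Lemma clopen_inU X A B :
  clopen_in X A -> clopen_in X B -> clopen_in X (A `|` B).
Proof.
move=> [Acl Aop] [Bcl Bop]; split; first exact: closed_in_setU.
by rewrite setDUr; exact: closed_in_cap.
Qed.

Lemma clopen_in_trans X A B :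
  clopen_in X A -> clopen_in A B -> clopen_in X B.
Proof.
move=> [[AX hA] Aop] [[BA hB] [_ hAB]]; split.
  split=> [M /BA/AX//|M [XM hM]]; apply: hB; split=> //.
  by apply: hA; split=> //; exact: hullS BA _ hM.
have -> : X `\` B = (X `\` A) `|` (A `\` B).
  apply/seteqP; split=> [M [XM nBM]|M [[XM nAM]|[AM nBM]]].
  - by have [AM|nAM] := pselect (A M); [right|left].
  - by split=> // /BA.
  - by split=> //; exact: AX.
apply: closed_in_setU => //; split=> [M [/AX]//|M [XM hM]]; apply: hAB.
split=> //; apply: hA; split=> //; apply: hullS hM => ? [].
by [].
Qed.

Lemma clopen_in_preimage X B phi : polymap phi -> phi @` X = X ->
  clopen_in X B -> clopen_in X (X `&` phi @^-1` B).
Proof.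
move=> phiP phiX [Bcl Bop]; split.
  by apply: closed_in_preimage; rewrite ?phiX.
have -> : X `\` (X `&` phi @^-1` B) = X `&` phi @^-1` (X `\` B).
  apply/seteqP; split=> M [XM nB]; split=> //.
    by split; [rewrite -phiX; exists M|move=> BM; apply: nB].
  by move=> [_ BM]; case: nB.
by apply: closed_in_preimage; rewrite ?phiX.
Qed.

Lemma zconnected_clopenP X : @connected (zariski F N) X <->
  forall B, B !=set0 -> clopen_in X B -> B = X.
Proof.
rewrite zconnectedP; split=> conn B B0; first by case; exact: conn.
by move=> Bcl Bop; exact: conn.
Qed.

End Clopen.

Section BilinearForms.
Variables (F : fieldType) (N : nat) (Psi : 'M[F]_N).

Lemma actZ (t : F) (A : 'M[F]_N) v : act (t *: A) v = t *: act A v.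
Proof. by rewrite /act linearZ -scalemxAr. Qed.

Lemma bilZ (s t : F) v w : bil Psi (s *: v) (t *: w) = s * t * bil Psi v w.
Proof.
by rewrite /bil linearZ -!scalemxAl -scalemxAr !mxE mulrA.
Qed.

Lemma bil_delta a b : bil Psi (delta_mx 0 a) (delta_mx 0 b) = Psi a b.
Proof. by rewrite /bil -rowE trmx_delta -colE !mxE. Qed.

Lemma act_mul (A B : 'M[F]_N) v : act (A *m B) v = act A (act B v).
Proof. by rewrite /act trmx_mul mulmxA. Qed.

Lemma act1 v : act (1%:M : 'M[F]_N) v = v.
Proof. by rewrite /act trmx1 mulmx1. Qed.

(** In its matrix form the relation can be transported along a field morphism. *)
Lemma bil_actP (A : 'M[F]_N) c :
  (forall v w, bil Psi (act A v) (act A w) = c * bil Psi v w) <->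
  A^T *m Psi *m A = c *: Psi.
Proof.
have bilE v w : bil Psi (act A v) (act A w) = (v *m (A^T *m Psi *m A) *m w^T) 0 0.
  by rewrite /bil /act trmx_mul trmxK !mulmxA.
have bilc v w : c * bil Psi v w = (v *m (c *: Psi) *m w^T) 0 0.
  by rewrite /bil -scalemxAr -scalemxAl [RHS]mxE.
split=> [eqb|eqA v w]; last by rewrite bilE bilc eqA.
apply/matrixP => a b; have := eqb (delta_mx 0 a) (delta_mx 0 b).
by rewrite bilE bilc -!rowE !trmx_delta -!colE ![col _ _ _ _]mxE ![row _ _ _ _]mxE.
Qed.

End BilinearForms.

Section Similitudes.
Variables (F : closedFieldType) (N : nat) (Psi : 'M[F]_N).
Hypothesis two_neq0 : 2 != 0 :> F.

(** A relation rather than a function, since the factor [c] is not determined when [Psi] is zero. *)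
Definition multiplier (A : 'M[F]_N) (c : F) : Prop := [/\ A \in unitmx, c != 0 &
  forall v w, bil Psi (act A v) (act A w) = c * bil Psi v w].

Lemma GIsoP A : GIso Psi A <-> exists c, multiplier A c.
Proof.
by split=> [[uA [c c0 cP]]|[c [uA c0 cP]]]; [exists c|split=> //; exists c].
Qed.

Lemma IsoP A : Iso Psi A <-> multiplier A 1.
Proof.
split=> [[uA AP]|[uA _ AP]]; split=> //; first exact: oner_neq0.
  by move=> v w; rewrite mul1r.
by move=> v w; rewrite AP mul1r.
Qed.

Lemma multiplierM A B c d :
  multiplier A c -> multiplier B d -> multiplier (A *m B) (c * d).
Proof.
move=> [uA c0 AP] [uB d0 BP]; split; rewrite ?unitmx_mul ?uA ?mulf_neq0 //.
by move=> v w; rewrite !act_mul AP BP mulrA.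
Qed.

Lemma multiplierV A c : multiplier A c -> multiplier (invmx A) c^-1.
Proof.
move=> [uA c0 AP]; split; rewrite ?unitmx_inv ?invr_eq0 // => v w.
apply: (mulfI c0); rewrite -AP -!act_mul mulmxV // !act1.
by rewrite mulrA divff // mul1r.
Qed.

Lemma multiplier_scalar t : t != 0 -> multiplier t%:M (t ^+ 2).
Proof.
move=> t0; split; rewrite ?expf_neq0 //.
  by rewrite -scalemx1 unitmxZ ?unitmx1 // unitfE.
by move=> v w; rewrite -scalemx1 !actZ !act1 bilZ.
Qed.

Lemma multiplierZ t A c :
  t != 0 -> multiplier A c -> multiplier (t *: A) (t ^+ 2 * c).
Proof.
by move=> t0 /(multiplierM (multiplier_scalar t0)); rewrite mul_scalar_mx.
Qed.

Lemma multiplier_uniq A c d :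
  Psi != 0 -> multiplier A c -> multiplier A d -> c = d.
Proof.
move=> /eqP Psi0 [_ _ AP] [_ _ AQ]; apply/eqP; rewrite -subr_eq0.
apply: contra_notT Psi0 => cd; apply/matrixP => a b; rewrite mxE -bil_delta.
apply: (mulfI cd); rewrite mulr0 mulrBl -AP -AQ subrr //.
Qed.

(** Dividing [A] by a square root of its multiplier gives an isometry. *)
Lemma GIso_root A : GIso Psi A ->
  exists (t : F) B, [/\ t != 0, Iso Psi B & A = t *: B].
Proof.
move=> /GIsoP [c cA]; have [_ c0 _] := cA.
have [t /rootP] : exists t, root ('X^2 - c%:P) t.
  by apply/closed_rootP; rewrite size_XnsubC.
rewrite !hornerE => /eqP; rewrite subr_eq0 => /eqP tc.
have t0 : t != 0 by apply: contraNneq c0 => t0; rewrite -tc t0 expr0n.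
have V0 : t^-1 != 0 by rewrite invr_eq0.
exists t, (t^-1 *: A); split=> //; last by rewrite scalerA divff ?scale1r.
apply/IsoP; have := multiplierZ V0 cA.
by rewrite -tc -exprMn mulVf // expr1n.
Qed.

(** The multiplier is read off on two basis vectors whose pairing [Psi a b] is not zero. *)
Lemma multiplier_polyfun : Psi != 0 -> exists2 chi, @polyfun F N chi &
  forall A c, multiplier A c -> chi A = c.
Proof.
move=> Psi0; have [a [b ab]] : exists a b, Psi a b != 0.
  apply: contrapT => nab; move/eqP: Psi0; apply; apply/matrixP => a b.
  by rewrite mxE; apply: contrapT => /eqP ab; apply: nab; exists a, b.
exists (fun A => (\sum_k (\sum_k' A k' a * Psi k' k) * A k b) * (Psi a b)^-1).
  apply: polyfunM; last exact: polyfun_cst.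
  apply: polyfun_sum => k; apply: polyfunM; last exact: polyfun_entry.
  apply: polyfun_sum => k'; apply: polyfunM; last exact: polyfun_cst.
  exact: polyfun_entry.
move=> A c [_ _ /(_ (delta_mx 0 a) (delta_mx 0 b))]; rewrite bil_delta => AP.
apply: (mulIf ab); rewrite divfK // -AP /bil /act -!rowE !mxE.
apply: eq_bigr => k _; rewrite !mxE; congr (_ * _).
by apply: eq_bigr => k' _; rewrite !mxE.
Qed.

(* Splitting the polynomial [t ^ m * p (t^-1 A)] of [t] into its even and odd
   parts, and replacing [t ^ 2] by [chi A]. *)
Lemma square_root_decomposition chi (p : {mpoly F[N * N]}) : polyfun chi ->
  exists m e o, [/\ @polyfun F N e, polyfun o & forall A t, t != 0 ->
    t ^+ 2 = chi A -> t ^+ m * mx_eval p (t^-1 *: A) = e A + t * o A].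
Proof.
move=> chiP; have powP m : exists e o, [/\ @polyfun F N e, polyfun o &
    forall A t, t ^+ 2 = chi A -> t ^+ m = e A + t * o A].
  elim: m => [|m [e [o [eP oP eoE]]]].
    exists (fun=> 1), (fun=> 0); split; try exact: polyfun_cst.
    by move=> A t _; rewrite mulr0 addr0.
  exists (fun A => chi A * o A), e; split=> //; first exact: polyfunM.
  by move=> A t tA; rewrite exprS (eoE _ _ tA) -tA; ring.
apply: (mx_eval_ind (P := fun f => exists m e o, [/\ @polyfun F N e, polyfun o &
  forall A t, t != 0 -> t ^+ 2 = chi A ->
  t ^+ m * f (t^-1 *: A) = e A + t * o A]) _ _ _ _ p) => [c|i j|f g|f g].
- exists 0%N, (fun=> c), (fun=> 0); split; try exact: polyfun_cst.
  by move=> A t _ _; rewrite mul1r mulr0 addr0.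
- exists 1%N, (fun A => A i j), (fun=> 0).
  split; [exact: polyfun_entry|exact: polyfun_cst|move=> A t t0 _].
  by rewrite mxE expr1 mulrA divff // mul1r mulr0 addr0.
- move=> [m [e [o [eP oP fE]]]] [m' [e' [o' [eP' oP' gE]]]].
  have [a [b [aP bP abE]]] := powP m; have [a' [b' [aP' bP' abE']]] := powP m'.
  exists (m + m')%N, (fun A => (a' A * e A + chi A * (b' A * o A)) +
    (a A * e' A + chi A * (b A * o' A))),
    (fun A => (a' A * o A + b' A * e A) + (a A * o' A + b A * e' A)).
  split; try by do !(apply: polyfunD || apply: polyfunM).
  move=> A t t0 tA; rewrite exprD mulrDr -mulrA (mulrCA (t ^+ m)).
  rewrite -[X in _ + X]mulrA fE // gE // (abE _ _ tA) (abE' _ _ tA) -tA.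
  by ring.
- move=> [m [e [o [eP oP fE]]]] [m' [e' [o' [eP' oP' gE]]]].
  exists (m + m')%N, (fun A => e A * e' A + chi A * (o A * o' A)),
    (fun A => e A * o' A + o A * e' A).
  split; try by do !(apply: polyfunD || apply: polyfunM).
  by move=> A t t0 tA; rewrite exprD mulrACA fE // gE // -tA; ring.
Qed.

Variable H : set 'M[F]_N.
Hypotheses (gH : mxgroup H) (H_conn : @connected (zariski F N) H).
Hypotheses (H_GIso : H `<=` GIso Psi) (H_hom : homotheties F N `<=` H).
Hypothesis Psi_neq0 : (0 < N)%N -> Psi != 0.
Let X := H `&` Iso Psi.

Let H_scale t A : t != 0 -> H A -> H (t *: A).
Proof.
move=> t0 HA; rewrite -mul_scalar_mx; apply: (mxgroupM gH) => //.
by apply: H_hom; exists t.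
Qed.

Let X_opp A : X A -> X (- A).
Proof.
move=> [HA /IsoP IA]; rewrite -scaleN1r.
have N1 : -1 != 0 :> F by rewrite oppr_eq0 oner_eq0.
split; first exact: H_scale.
by apply/IsoP; have := multiplierZ N1 IA; rewrite sqrrN expr1n mulr1.
Qed.

Let H_root A : H A -> exists (t : F) B, [/\ t != 0, X B & A = t *: B].
Proof.
move=> HA; have [t [B [t0 IB DA]]] := GIso_root (H_GIso HA); exists t, B.
split=> //; split=> //; have -> : B = t^-1 *: A.
  by rewrite DA scalerA mulVf // scale1r.
by apply: H_scale => //; rewrite invr_eq0.
Qed.

(** The cone over [B] and the cone over its complement are closed and complementary in the connected
    group [H], so the first one is all of [H]. *)
Let clopen_opp_invariant (B : set 'M[F]_N) :
  B !=set0 -> (forall A, B A -> B (- A)) -> clopen_in X B -> B = X.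
Proof.
have [N0|N_gt0] := posnP N.
  move=> [A BA] _ [[BX _] _]; apply/seteqP; split=> // A' _.
  suff -> : A' = A by [].
  by move: (N0) A A' {BA}; clear; case: N => // _ A A'; rewrite !flatmx0.
have Psi0 := Psi_neq0 N_gt0; have [chi chiP chiE] := multiplier_polyfun Psi0.
pose cone (B' : set 'M[F]_N) : set 'M[F]_N :=
  [set A | exists (t : F) A', [/\ t != 0, B' A' & A = t *: A']].
have cone_closed (B' : set 'M[F]_N) : (forall A, B' A -> B' (- A)) ->
    closed_in X B' -> closed_in H (cone B').
  move=> B'opp [B'X hB']; split.
    by move=> _ [t [A [t0 /B'X [HA _] ->]]]; exact: H_scale.
  move=> _ [/H_root [t [A [t0 XA ->]]] hA]; exists t, A; split=> //.
  apply: hB'; split=> // p p0.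
  have [m [e [o [[e' eE] [o' oE] pE]]]] := square_root_decomposition p chiP.
  have chi_scale s A' : s != 0 -> X A' -> chi (s *: A') = s ^+ 2.
    move=> s0 [_ /IsoP mA']; rewrite (chiE _ _ (multiplierZ s0 mA')) mulr1 //.
  (* Both [s] and [- s] are square roots of [chi] at [s *: A''], and [B'] is stable under opposites;
     hence [e + s o] and [e - s o] vanish there, and so do [e] and [o]. *)
  have eo0 A' : cone B' A' -> e A' = 0 /\ o A' = 0.
    move=> [s [A'' [s0 BA'' ->]]].
    have XA'' := B'X _ BA''.
    have Ns0 : - s != 0 by rewrite oppr_eq0.
    have := pE (s *: A'') s s0; rewrite chi_scale // => /(_ erefl).
    rewrite scalerA mulVf // scale1r p0 // mulr0.
    have := pE (s *: A'') (- s) Ns0; rewrite chi_scale // sqrrN => /(_ erefl).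
    rewrite scalerA invrN mulNr mulVf // scaleN1r p0 ?mulr0; last exact: B'opp.
    move: (e _) (o _) => x y xy1 xy2.
    have : 2 * x = (x + s * y) + (x + - s * y) by ring.
    rewrite -xy1 -xy2 addr0 => /eqP; rewrite mulf_eq0 (negbTE two_neq0) => /eqP.
    have : 2 * s * y = (x + s * y) - (x + - s * y) by ring.
    rewrite -xy1 -xy2 subr0 => /eqP; rewrite !mulf_eq0 (negbTE two_neq0).
    by rewrite (negbTE s0) => /eqP.
  have := pE (t *: A) t t0; rewrite chi_scale // => /(_ erefl).
  rewrite scalerA mulVf // scale1r.
  rewrite -eE -oE (hA e') ?(hA o') => [|A' /eo0 [_ <-]|A' /eo0 [<- _]] //.
  rewrite mulr0 addr0 => /eqP.
  by rewrite mulf_eq0 expf_eq0 (negbTE t0) andbF => /eqP.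
move=> [A0 BA0] Bopp [Bcl Bop].
have BX := Bcl.1.
have nBopp A : (X `\` B) A -> (X `\` B) (- A).
  move=> [XA nBA]; split; first exact: X_opp.
  by move=> /Bopp; rewrite opprK.
(* If [t *: A = s *: A'], comparing multipliers gives [t ^+ 2 = s ^+ 2], so [A] is [A'] or [- A'];
   thus the two cones are disjoint. *)
have coneC : H `\` cone B = cone (X `\` B).
  apply/seteqP; split=> [A [HA nA]|_ [t [A [t0 [XA nBA] ->]]]].
    have [t [A' [t0 XA' DA]]] := H_root HA; exists t, A'; split=> //.
    by split=> // BA'; apply: nA; exists t, A'.
  split; first by apply: H_scale => //; case: XA.
  move=> [s [A' [s0 BA' DA]]].
  have [_ /IsoP mA] := XA; have [_ /IsoP mA'] := BX _ BA'.
  have mt := multiplierZ t0 mA; have ms := multiplierZ s0 mA'.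
  rewrite DA in mt; have := multiplier_uniq Psi0 mt ms; rewrite !mulr1 => /eqP.
  rewrite eqf_sqr => /orP [] /eqP ts; apply: nBA.
    suff -> : A = A' by [].
    by apply: (scalerI s0); rewrite -DA ts.
  suff -> : A = - A' by exact: Bopp.
  by apply: (scalerI s0); rewrite scalerN -DA ts scaleNr opprK.
move/zconnected_clopenP: H_conn => /(_ (cone B)) DH.
have coneB_cl : clopen_in H (cone B).
  by split; [exact: cone_closed|rewrite coneC; exact: cone_closed].
have DB : cone B = H.
  by apply: DH => //; exists A0; exists 1, A0; rewrite oner_neq0 scale1r.
apply/seteqP; split=> // A XA; apply: contrapT => nBA.
have : (H `\` cone B) A.
  by rewrite coneC; exists 1, A; rewrite oner_neq0 scale1r.
by rewrite DB => -[].
Qed.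

(** If [X] is not connected, it has a proper clopen part [B] containing [1]. Then [X] is the
    disjoint union of [B] and [- B], and [B] is connected. *)
Lemma isometries_two_components :
  X = id_component X `|` mulset [set - 1%:M] (id_component X).
Proof.
have negE S : mulset [set - 1%:M] S = [set A : 'M[F]_N | S (- A)].
  apply/seteqP; split=> [_ [_ -> [A SA <-]]|A SA].
    by rewrite /= mulNmx mul1mx opprK.
  by exists (- 1%:M) => //; exists (- A); rewrite // mulNmx mul1mx opprK.
rewrite negE; apply/seteqP; split; last first.
  move=> A [|] /(@connected_component_sub (zariski F N)) //.
  by move=> /X_opp; rewrite opprK.
have X1 : X 1%:M.
  split; first exact: (mxgroup1 gH).
  by split=> [|v w]; rewrite ?unitmx1 ?act1.
have [conn|nconn] := pselect (@connected (zariski F N) X).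
  move=> A XA; left; rewrite /id_component /zcomponent.
  by rewrite (@connected_component_id (zariski F N)).
have {nconn} [B [B1 Bclo BX]] : exists B, [/\ B 1%:M, clopen_in X B & B <> X].
  apply: contrapT => noB; apply: nconn; apply/zconnected_clopenP => B [A BA] Bclo.
  apply: contrapT => BX; apply: noB.
  have [B1|nB1] := pselect (B 1%:M); first by exists B.
  exists (X `\` B); split=> //; first exact: clopen_inC.
  move=> DX; have : (X `\` B) A by rewrite DX; exact: Bclo.1.1.
  by case.
pose phi : 'M[F]_N -> 'M[F]_N := mulmx (- 1%:M).
have phiE A : phi A = - A by rewrite /phi mulNmx mul1mx.
have phiX : phi @` X = X.
  apply/seteqP; split=> [_ [A XA <-]|A XA]; first by rewrite phiE; exact: X_opp.
  by exists (- A); [exact: X_opp|rewrite phiE opprK].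
pose opp (B' : set 'M[F]_N) := X `&` phi @^-1` B'.
have opp_clopen B' : clopen_in X B' -> clopen_in X (opp B').
  by apply: clopen_in_preimage => //; exact: polymap_mull.
have cover B' : B' !=set0 -> clopen_in X B' -> B' `|` opp B' = X.
  move=> [A BA] Bclo'; apply: clopen_opp_invariant.
  - by exists A; left.
  - move=> A' [BA'|[XA' /=]]; last by rewrite phiE; left.
    right; split; first by apply: X_opp; exact: Bclo'.1.1.
    by rewrite /= phiE opprK.
  - by apply: clopen_inU => //; exact: opp_clopen.
(* The intersection of [B] and [- B] is clopen and stable under opposites: if it were nonempty it
   would be [X], and [B] too. *)
have disj A : B A -> B (- A) -> False.
  move=> BA BNA; apply: BX; have XE : B `&` opp B = X.
    apply: clopen_opp_invariant.
    - exists A; split=> //; split; first exact: Bclo.1.1.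
      by rewrite /= phiE.
    - move=> A' [BA' [XA' /=]]; rewrite phiE => BNA'; split=> //.
      by split; [exact: X_opp|rewrite /= phiE opprK].
    - by apply: clopen_inI => //; exact: opp_clopen.
  by apply/seteqP; split; [exact: Bclo.1.1|rewrite -XE => A' []].
(* A nonempty clopen part [B'] of [B] covers [X] together with [- B']; as [- B'] lies in [- B],
   which is disjoint from [B], this forces [B' = B]. *)
have B_conn : @connected (zariski F N) B.
  apply/zconnected_clopenP => B' B'0 B'clo.
  have DX := cover B' B'0 (clopen_in_trans Bclo B'clo).
  apply/seteqP; split; first exact: B'clo.1.1.
  move=> A BA; have : X A by exact: Bclo.1.1.
  rewrite -DX => -[//|[_ /=]]; rewrite phiE => /(B'clo.1.1) BNA.
  by case: (disj A).
have sub : B `<=` id_component X.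
  by apply: (@connected_component_max (zariski F N)) => //; exact: Bclo.1.1.
move=> A; rewrite -{1}(cover B _ Bclo); last by exists 1%:M.
move=> [BA|[_ /=]]; first by left; exact: sub.
by rewrite phiE => BNA; right; exact: sub.
Qed.

End Similitudes.

(** * Zariski closures of groups of matrices *)

Section ZariskiClosure.
Variables (F : closedFieldType) (N : nat) (Psi : 'M[F]_N) (S : set 'M[F]_N).
Hypotheses (gS : mxgroup S) (S_GIso : S `<=` GIso Psi).

(** Stability under products takes two steps: left translations by elements of [S] preserve
    [hull S], and then right translations by elements of the closure do. *)
Lemma mxgroup_closure : mxgroup (GIso Psi `&` hull S).
Proof.
split.
- split; last by apply: sub_hull; exact: (mxgroup1 gS).
  by apply: S_GIso; exact: (mxgroup1 gS).
- move=> A B [/GIsoP [c cA] hA] [/GIsoP [d dB] hB]; split.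
    by apply/GIsoP; exists (c * d); exact: multiplierM.
  have SB s : S s -> hull S (s *m B).
    move=> Ss; apply: hullS (hull_polymap (polymap_mull s) hB).
    by move=> _ [s' Ss' <-]; exact: (mxgroupM gS).
  apply: hull_hull; apply: hullS (hull_polymap (polymap_mulr B) hA).
  by move=> _ [s Ss <-]; exact: SB.
- move=> A [/GIsoP [c cA] hA]; have uA : A \in unitmx by case: cA.
  split=> //; split; first by apply/GIsoP; exists c^-1; exact: multiplierV.
  by apply: hull_inv => // B; exact: (mxgroupV gS).
Qed.

End ZariskiClosure.

Section IdComponentClosure.
Variables (F : closedFieldType) (N : nat) (Psi : 'M[F]_N) (S : set 'M[F]_N).
Hypotheses (gS : mxgroup S) (S_GIso : S `<=` GIso Psi).
Let G := GIso Psi `&` hull S.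
Let C := id_component G.
Let gG : mxgroup G := mxgroup_closure gS S_GIso.

Lemma sub_closure : S `<=` G.
Proof. by move=> A SA; split; [exact: S_GIso|exact: sub_hull]. Qed.

Variables (T : finType) (gs : T -> 'M[F]_N).
Hypothesis gs_S : forall t, S (gs t).
Hypothesis gs_cosets : forall s, S s -> exists t, C (invmx (gs t) *m s).

(** The closure [D] of [S :&: C] is a subgroup contained in [C], and finitely many translates of it
    cover [G]. It is therefore clopen in [G], hence in the connected set [C]. *)
Lemma id_component_closure : GIso Psi `&` hull (S `&` C) = C.
Proof.
have gC := mxgroup_id_component gG.
have CG : C `<=` G := @id_component_sub _ _ G.
set D := GIso Psi `&` hull (S `&` C).
have S'G : S `&` C `<=` D.
  by move=> A SCA; split; [exact: S_GIso SCA.1|exact: sub_hull].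
have DG : D `<=` G.
  by move=> A [GA hA]; split=> //; apply: hullS hA => ? [].
have DC : D `<=` C.
  move=> A DA; apply: (mxgroup_closed_id_component gG).2.
  by split; [exact: DG|apply: hullS DA.2 => ? []].
have coset_hull A t : G A -> hull (mulmx (gs t) @` (S `&` C)) A ->
    D (invmx (gs t) *m A).
  move=> GA hA; have [u_t Gt] := mxgroupV gG (sub_closure (gs_S t)).
  split; first by have [] := mxgroupM gG Gt GA.
  apply: hullS (hull_polymap (polymap_mull (invmx (gs t))) hA).
  by rewrite mulKVmx_set.
have coset_ex A : G A -> exists t, D (invmx (gs t) *m A).
  move=> GA.
  have [t tA] : exists t, hull (mulmx (gs t) @` (S `&` C)) A.
    apply: hull_bigcup; apply: hullS GA.2 => s Ss; have [t Ct] := gs_cosets Ss.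
    have [u_t St] := mxgroupV gS (gs_S t).
    exists t, (invmx (gs t) *m s); last by rewrite mulKVmx.
    by split=> //; exact: (mxgroupM gS).
  by exists t; exact: coset_hull.
have gD : mxgroup D.
  have gSC : mxgroup (S `&` C).
    split; first by split; [exact: (mxgroup1 gS)|exact: (mxgroup1 gC)].
      move=> A B [SA CA] [SB CB].
      by split; [exact: (mxgroupM gS)|exact: (mxgroupM gC)].
    by move=> A [/(mxgroupV gS) [uA SV] /(mxgroupV gC) [_ CV]].
  by apply: mxgroup_closure => // ? [/S_GIso].
have D_clopen : clopen_in G D.
  split.
    split=> // B [[GB _] hB]; split=> //; apply: hull_hull.
    by apply: hullS hB => ? [].
  split=> [B []//|B [GB hB]]; split=> // DB.
  (* A point [B] in the closure of the complement of [D] is in the closure of one translate of [D]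
     by some [gs t] outside [D]. Translates of [D] are closed in [G], so [B] in [D] would put [gs t]
     in [D]. *)
  have [t [nDt htB]] : exists t, ~ D (gs t) /\ hull (mulmx (gs t) @` D) B.
    have [t htB] : exists t, hull [set M | ~ D (gs t) /\ (mulmx (gs t) @` D) M] B.
      apply: hull_bigcup; apply: hullS hB => M [GM nDM].
      have [t Dt] := coset_ex M GM.
      have [u_t _] := mxgroupV gG (sub_closure (gs_S t)).
      exists t; split.
        move=> Dgt; apply: nDM; have := mxgroupM gD Dgt Dt.
        by rewrite mulKVmx.
      by exists (invmx (gs t) *m M); rewrite ?mulKVmx.
    exists t; split; last by apply: hullS htB => ? [].
    move=> Dt; have : hull set0 B by apply: hullS htB => ? [].
    move=> /(_ 1) /= H; have /eqP := H (fun M (e : set0 M) => match e with end).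
    by rewrite /mx_eval meval1 oner_eq0.
  have [u_t Gt] := mxgroupV gG (sub_closure (gs_S t)).
  apply: nDt; have DtB : D (invmx (gs t) *m B).
    split; first by have [] := mxgroupM gG Gt GB.
    apply: hull_hull; apply: hullS (hull_polymap (polymap_mull (invmx (gs t))) htB).
    by rewrite mulKVmx_set // => M [].
  have [uV DV] := mxgroupV gD DtB.
  rewrite -(mulKVmx u_t B) in DB; have := mxgroupM gD DB DV.
  by rewrite mulmxK.
have DcapC M : closed_in G M -> closed_in C (M `&` C).
  by move=> /(closed_in_setI C); rewrite (setIidr CG).
have /zconnected_clopenP conn := @id_component_connected _ _ G.
apply: conn.
  by exists 1%:M; exact: (mxgroup1 gD).
have [Dcl Dop] := D_clopen; split.
  by have := DcapC _ Dcl; rewrite setIidl.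
have -> : C `\` D = (G `\` D) `&` C.
  apply/seteqP; split=> [M [CM nDM]|M [[_ nDM] CM]] //.
  by split=> //; split=> //; exact: CG.
exact: DcapC.
Qed.

End IdComponentClosure.

(* Each linear relation among the coefficients [b] that is realized on [S]
   lets one shorten the sum. *)
Lemma vanish_descent (F L : fieldType) (iota : {rmorphism F -> L}) (N r : nat)
    (b : 'I_r -> L) (q : 'I_r -> {mpoly F[N * N]}) (S : set 'M[F]_N)
    (A' : 'M[L]_N) :
  (forall p : {mpoly F[N * N]}, (forall A, S A -> mx_eval p A = 0) ->
    mx_eval (map_mpoly iota p) A' = 0) ->
  (forall A, S A -> \sum_i b i * iota (mx_eval (q i) A) = 0) ->
  \sum_i b i * mx_eval (map_mpoly iota (q i)) A' = 0.
Proof.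
move=> hA'; elim: r b q => [|r IH] b q bq0; first by rewrite big_ord0.
have [all0|] := pselect (forall k A, S A -> mx_eval (q k) A = 0).
  by rewrite big1 // => k _; rewrite hA' ?mulr0 // => A; exact: all0.
move=> /existsNP [k /existsNP [A /not_implyP [SA /eqP qkA]]].
pose c i := mx_eval (q i) A / mx_eval (q k) A.
(* The relation at [A] eliminates [b k]; each other [q i] is corrected by the multiple of [q k] that
   makes it vanish at [A]. *)
have sumE (x : 'I_r.+1 -> L) : \sum_i b i * x i =
    \sum_i b (lift k i) * (x (lift k i) - iota (c (lift k i)) * x k).
  have bk : b k = - \sum_i b (lift k i) * iota (c (lift k i)).
    have k0 : iota (mx_eval (q k) A) != 0 by rewrite fmorph_eq0.
    apply: (mulIf k0); have := bq0 A SA; rewrite (bigD1_ord k) //= => /eqP.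
    rewrite addr_eq0 => /eqP ->; rewrite mulNr mulr_suml; congr (- _).
    by apply: eq_bigr => i _; rewrite -mulrA -rmorphM /= divfK.
  rewrite (bigD1_ord k) //= bk mulNr mulr_suml addrC -sumrN -big_split /=.
  by apply: eq_bigr => i _; ring.
have qE i : mx_eval (map_mpoly iota (q (lift k i) - c (lift k i) *: q k)) A' =
    mx_eval (map_mpoly iota (q (lift k i))) A' -
    iota (c (lift k i)) * mx_eval (map_mpoly iota (q k)) A'.
  by rewrite rmorphB /= map_mpolyZ /mx_eval mevalB mevalZ.
rewrite sumE; under eq_bigr do rewrite -qE; apply: IH => B SB.
apply: etrans (bq0 B SB); rewrite [RHS]sumE; apply: eq_bigr => i _.
by rewrite /mx_eval mevalB mevalZ rmorphB rmorphM.
Qed.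

Section ZariskiClosureRep.
Variables (R : realType) (K : fieldType) (Kbar : algClosure K).
Variables (l : primenat) (Ql : padicField R l) (Qlbar : algClosure Ql).
Variables (N : nat) (Psi : 'M[rat]_N) (rho : padic_rep Kbar Ql N).
Let iota := ac_emb Qlbar.

Definition rep_bar (g : absgal Kbar) : 'M[Qlbar]_N := map_mx iota (rho g).

Lemma mx_eval_map (p : {mpoly Ql[N * N]}) (A : 'M[Ql]_N) :
  mx_eval (map_mpoly iota p) (map_mx iota A) = iota (mx_eval p A).
Proof.
elim/mpolyind: p => [|c m p _ _ IH].
  by rewrite rmorph0 /mx_eval !meval0 rmorph0.
rewrite rmorphD /= map_mpolyZ map_mpolyX /mx_eval !mevalD !mevalZ !mevalX.
rewrite rmorphD rmorphM rmorph_prod -IH; congr (_ * _ + _).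
apply: eq_bigr => i _; rewrite rmorphXn /=; congr (_ ^+ _).
by rewrite -map_mxvec mxE.
Qed.

(** Zariski closure commutes with extension of the base field: a polynomial over the closure is a
    combination of monomials, which are defined over [Ql], so [vanish_descent] applies. *)
Lemma Galg_hull (U : set (absgal Kbar)) :
  Galg Qlbar Psi rho U = GIso (Psi_bar Qlbar Psi) `&` hull (rep_bar @` U).
Proof.
apply/seteqP; split=> A [GA hA]; split=> //.
  move=> p p0; pose ms := msupp p.
  have pE B : mx_eval p B = \sum_(i < size ms) p@_(nth 0%MM ms i) *
      mx_eval (map_mpoly iota (mpolyX Ql (nth 0%MM ms i))) B.
    rewrite /mx_eval {1}(mpolyE p) raddf_sum (big_nth 0%MM) big_mkord /=.
    by apply: eq_bigr => i _; rewrite mevalZ map_mpolyX.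
  rewrite pE; apply: (vanish_descent (S := rho @` U)) => [q q0|_ [g Ug <-]].
    by apply: hA => g Ug; apply: q0; exists g.
  have pg0 : mx_eval p (rep_bar g) = 0 by apply: p0; exists g.
  apply: etrans pg0; rewrite pE.
  by apply: eq_bigr => i _; rewrite /rep_bar mx_eval_map.
move=> p p0; apply: hA => _ [g Ug <-].
by rewrite /rep_bar mx_eval_map p0 // rmorph0.
Qed.

End ZariskiClosureRep.

(** * Galois groups and their representations *)

Section AbsoluteGalois.
Variables (K : fieldType) (Kbar : algClosure K).

Lemma absgal_eq (g h : absgal Kbar) : (forall x, g x = h x) -> g = h.
Proof.
case: g => [[gf gc] gb gfix]; case: h => [[hf hc] hb hfix] /= /funext Dh.
rewrite /= in Dh; subst hf.
have Dc : gc = hc.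
  case: gc {gb gfix} => [[ga] [gm]]; case: hc {hb hfix} => [[ha] [hm]].
  by congr GRing.RMorphism.Class; f_equal; exact: Prop_irrelevance.
subst hc; congr AbsGal; exact: Prop_irrelevance.
Qed.

Lemma galV (g : absgal Kbar) : exists h : absgal Kbar,
  galM g h = gal1 Kbar /\ galM h g = gal1 Kbar.
Proof.
have [f gK fK] := gal_bij g.
have f_zmod : zmod_morphism f.
  by move=> x y; apply: (can_inj gK); rewrite rmorphB !fK.
have f_monoid : monoid_morphism f.
  split=> [|x y]; apply: (can_inj gK); first by rewrite rmorph1 fK.
  by rewrite rmorphM !fK.
pose fB := GRing.isZmodMorphism.Build Kbar Kbar f f_zmod.
pose fM := GRing.isMonoidMorphism.Build Kbar Kbar f f_monoid.
pose fr : {rmorphism Kbar -> Kbar} := HB.pack f fB fM.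
have f_bij : bijective fr by exists g.
have f_fix x : fr (ac_emb Kbar x) = ac_emb Kbar x.
  by apply: (can_inj gK); rewrite /= fK gal_fix.
by exists (AbsGal f_bij f_fix); split; apply: absgal_eq => x /=.
Qed.

Lemma galMA (g h f : absgal Kbar) : galM g (galM h f) = galM (galM g h) f.
Proof. exact: absgal_eq. Qed.

Lemma gal1M (g : absgal Kbar) : galM (gal1 Kbar) g = g.
Proof. exact: absgal_eq. Qed.

End AbsoluteGalois.

(** The restriction of [g] to [L] is determined by the images of a basis, each of which is one of
    the finitely many roots of an annihilator; [code] records their positions. *)
Lemma gal_over_finite_index (K : fieldType) (Kbar : algClosure K)
    (L : fieldExtType K) (j : {rmorphism L -> Kbar}) :
    (forall a : K, j a%:A = ac_emb Kbar a) ->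
  exists (T : finType) (gs : T -> absgal Kbar),
    forall g, exists t h, gal_over j h /\ galM (gs t) h = g.
Proof.
move=> jK; pose n : nat := \dim {:L}; pose b (i : 'I_n) : L := (vbasis {:L})`_i.
have rootsP (i : 'I_n) : exists rs : seq Kbar, forall g : absgal Kbar,
    g (j (b i)) \in rs.
  have [f f0 fx] := ac_alg (a := Kbar) (j (b i)).
  have [rs Drs] := closed_field_poly_normal (map_poly (ac_emb Kbar) f).
  exists rs => g; have : root (map_poly (ac_emb Kbar) f) (g (j (b i))).
    rewrite -(eq_map_poly (gal_fix g)) map_poly_comp.
    exact: rmorph_root.
  by rewrite Drs rootZ ?root_prod_XsubC // lead_coef_eq0 map_poly_eq0.
have [rs rsP] := choice rootsP.
pose m : nat := \max_(i < n) size (rs i).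
pose code (g : absgal Kbar) : {ffun 'I_n -> 'I_m.+1} :=
  [ffun i : 'I_n => inord (index (g (j (b i))) (rs i))].
have codeP g h : code g = code h -> forall x, g (j x) = h (j x).
  move=> gh x; rewrite (coord_vbasis (memvf x)) !rmorph_sum.
  apply: eq_bigr => i _; rewrite -mulr_algl !rmorphM /= jK !gal_fix.
  rewrite -/(b i); congr (_ * _); have /ffunP /(_ i) := gh; rewrite !ffunE.
  have lt (f : absgal Kbar) : (index (f (j (b i))) (rs i) < m.+1)%N.
    by rewrite ltnS (leq_trans (index_size _ _)) // (leq_bigmax i).
  move=> /(congr1 (@nat_of_ord _)); rewrite !inordK // => eq_index.
  by rewrite -(nth_index 0 (rsP i g)) eq_index nth_index.
(* A code that is not attained receives the identity as default. *)
have repP (t : {ffun 'I_n -> 'I_m.+1}) : exists g, forall h, code h = t ->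
    code g = t.
  have [[g gt]|none] := pselect (exists g, code g = t); first by exists g.
  by exists (gal1 Kbar) => h ht; case: none; exists h.
have [gs gsP] := choice repP.
exists {ffun 'I_n -> 'I_m.+1}, gs => g.
have [k [gk kg]] := galV (gs (code g)).
exists (code g), (galM k g); split; last by rewrite galMA gk gal1M.
move=> x; rewrite /= -(codeP _ _ (gsP _ g erefl)).
by have := congr1 (fun h : absgal Kbar => h (j x)) kg.
Qed.

(** By positivity, a zero form would make all the Hodge components zero, while they span the
    space. *)
Lemma ph_form_neq0 (R : realType) (N : nat) (n : int)
  (H : polarized_hodge R N n) : (0 < N)%N -> ph_form H != 0.
Proof.
move=> N_gt0; apply/eqP => Psi0; have [_ Hsum _] := ph_sum H.
have comp0 p : ph_comp H p = 0.
  apply/eqP/rowV0P => v vp; apply: contrapT => /eqP v0.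
  have := ph_pos vp v0.
  by rewrite Psi0 map_mx0 /bil mulmx0 mul0mx mxE mulr0 ltxx.
have := mxrank1 R[i] N; rewrite -Hsum big1 ?mxrank0 //.
by move=> N0; rewrite -N0 in N_gt0.
Qed.

Section Representation.
Variables (R : realType) (K : fieldType) (Kbar : algClosure K).
Variables (l : primenat) (Ql : padicField R l) (Qlbar : algClosure Ql).
Variables (N : nat) (n : int) (H : polarized_hodge R N n).
Variable rho : padic_rep Kbar Ql N.
Hypothesis rho_psi : form_equivariant n (ph_form H) rho.
Let Psi : 'M[Qlbar]_N := Psi_bar Qlbar (ph_form H).
Local Notation rb := (rep_bar Qlbar rho).

Lemma Psi_bar_neq0 : (0 < N)%N -> Psi != 0.
Proof.
move=> /(ph_form_neq0 H); apply: contra => /eqP P0; apply/eqP.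
by apply: (map_mx_inj (f := ac_emb Qlbar \o Qp_emb Ql)); rewrite map_mx0.
Qed.

Lemma rep_bar1 : rb (gal1 Kbar) = 1%:M.
Proof. by rewrite /rep_bar rep1 map_mx1. Qed.

Lemma rep_barM g h : rb (galM g h) = rb g *m rb h.
Proof. by rewrite /rep_bar repM map_mxM. Qed.

Lemma rep_barV g : exists h, galM g h = gal1 Kbar /\
  rb g \in unitmx /\ invmx (rb g) = rb h.
Proof.
have [h [gh hg]] := galV g; exists h; split=> //.
have rgh : rb g *m rb h = 1%:M by rewrite -rep_barM gh rep_bar1.
have [ug _] := mulmx1_unit rgh; split=> //.
by rewrite -[LHS]mulmx1 -rgh mulKmx.
Qed.

Lemma rep_bar_group (U : set (absgal Kbar)) : U (gal1 Kbar) ->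
    (forall g h, U g -> U h -> U (galM g h)) ->
    (forall g h, U g -> galM g h = gal1 Kbar -> U h) ->
  mxgroup (rb @` U).
Proof.
move=> U1 UM UV; split.
- by exists (gal1 Kbar); rewrite ?rep_bar1.
- move=> _ _ [g Ug <-] [h Uh <-]; exists (galM g h); rewrite ?rep_barM //.
  exact: UM.
- move=> _ [g Ug <-]; have [h [gh [ug ->]]] := rep_barV g; split=> //.
  by exists h => //; exact: UV gh.
Qed.

Lemma rep_bar_GIso g : GIso Psi (rb g).
Proof.
have [h [_ [ug _]]] := rep_barV g; split=> //.
pose c : Qlbar := ac_emb Qlbar (cyclo Ql g ^ (- n)).
have gE v w : bil Psi (act (rb g) v) (act (rb g) w) = c * bil Psi v w.
  move: v w; apply/bil_actP.
  have /bil_actP /(congr1 (map_mx (ac_emb Qlbar))) := rho_psi g.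
  by rewrite !map_mxM map_trmx map_mxZ -map_mx_comp.
(* Since [cyclo] is a choice with default [0], the factor [c] is shown to be nonzero by means of the
   form, which is nonzero for [N > 0], and of the invertibility of [rb g]. *)
have [c0|c0] := eqVneq c 0; last by exists c.
have [N0|N_gt0] := posnP N.
  exists 1; first exact: oner_neq0.
  apply/bil_actP/matrixP => a.
  suff : False by [].
  by have := leq_ltn_trans (leq0n a) (ltn_ord a); rewrite N0.
case/negP: (Psi_bar_neq0 N_gt0); apply/eqP/matrixP => a b.
rewrite -bil_delta mxE -(act1 (delta_mx 0 a)) -(act1 (delta_mx 0 b)).
by rewrite -(mulmxV ug) !act_mul gE c0 mul0r.
Qed.

End Representation.

(** The powers of the image of one Frobenius element outside the exceptional set of [weight]
    suffice; their absolute value is not [1] because [n] is not zero and [prime_norm v > 1]. *)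
Lemma Galg_homotheties (R : realType) (K : fieldExtType rat)
    (Kbar : algClosure K) (Ql : forall l : primenat, padicField R l)
    (Qlbar : forall l : primenat, algClosure (Ql l)) (N : nat) (n : int)
    (rho : forall l : primenat, padic_rep Kbar (Ql l) N) (Psi : 'M[rat]_N)
    (l : primenat) :
  n != 0 -> frobenius_weight rho Qlbar n ->
  homotheties (Qlbar l) N `<=` Galg (Qlbar l) Psi (rho l) setT.
Proof.
move=> n_neq0 weight _ [t t_neq0 <-]; split.
  by apply/GIsoP; exists (t ^+ 2); exact: multiplier_scalar.
move=> p p0; have [T [Tfin _ Tweight]] := weight l.
have [v [g [vp nTv frob q_gt1]]] := exists_frobenius Kbar Tfin.
have Nn : - n != 0 by rewrite oppr_eq0.
have [r_gt0 r_neq1] := weight_abs_neq1 R q_gt1 Nn.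
apply: (homotheties_of_weight r_gt0 r_neq1 (Tweight v vp nTv g frob)) => k.
have [h ->] : exists h, iter k (mulmx (rep_bar (Qlbar l) (rho l) g)) 1%:M =
    rep_bar (Qlbar l) (rho l) h.
  elim: k => [|k [h /= ->]]; first by exists (gal1 Kbar); rewrite rep_bar1.
  by exists (galM g h); rewrite rep_barM.
by rewrite /rep_bar mx_eval_map p0 // rmorph0.
Qed.

(** * Components of the algebraic monodromy group and of its isometries *)

Theorem theorem5p10
  (R : realType)
  (* the number field K, its algebraic closure, and for each prime l (and
     each prime lam of K over l) the fields Q_l, its closure, and C_l *)
  (K : fieldExtType rat) (Kbar : algClosure K)
  (Ql : forall l : primenat, padicField R l)
  (Qlbar : forall l : primenat, algClosure (Ql l))
  (Cl : forall (l : primenat) (lam : set K),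
     above l lam -> Cl_completion Kbar (Ql l) lam)
  (* (V, psi), of weight n *)
  (N : nat) (n : int) (n_neq0 : n != 0) (H : polarized_hodge R N n)
  (* the representations *)
  (rho : forall l : primenat, padic_rep Kbar (Ql l) N)
  (rho_psi : forall l, form_equivariant n (ph_form H) (rho l))
  (* (D1), (D2) *)
  (D : {pred 'M[rat]_N}) (D_ring : subring_closed D)
  (D1 : preserves_hodge H D)
  (e : absgal Kbar -> 'M[rat]_N -> 'M[rat]_N) (D2 : discrete_module D e)
  (* de Rham data, (DR1), (DR2) *)
  (DR : deRham K H) (DR1 : deRham_action Kbar DR D)
  (DR2 : preserves_deRham DR1)
  (* (R1) - (R4) *)
  (R1_compatible : strictly_compatible rho)
  (R1_HT : forall (l : primenat) (lam : set K) (llam : above l lam),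
     hodge_tate (Cl l lam llam) (rho l))
  (R2 : frobenius_weight rho Qlbar n)
  (R4 : forall l : primenat, D_equivariant D e (rho l))
  (R3_R4 : forall (l : primenat) (lam : set K) (llam : above l lam),
     exists f : int -> 'M[Cl l lam llam]_N,
       HT_decomposition DR (rho l) f /\ HT_compatible DR1 f)
  (* the prime l and the finite Galois extension K0 / K *)
  (l : primenat)
  (K0 : splittingFieldType K) (K0_galois : galois 1%AS {:K0})
  (j : {rmorphism K0 -> Kbar}) (jK : forall a : K, j a%:A = ac_emb Kbar a)
  (K0E : [set g | id_component (Galg (Qlbar l) (ph_form H) (rho l) setT)
                    (map_mx (ac_emb (Qlbar l)) (rho l g))] = gal_over j) :
  let G := Galg (Qlbar l) (ph_form H) (rho l) setT in
  let G1 := Galg1 (Qlbar l) (ph_form H) (rho l) setT in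
  let G1_K0 := Galg1 (Qlbar l) (ph_form H) (rho l) (gal_over j) in
  let C := id_component G1 in
  let negC := mulset [set - 1%:M] C in
  (* (a) *)
  G1_K0 = C `|` negC /\
  (* (b) *)
  pi0_epi G1 G (pi0_incl G) /\
  pi0_ker G1 G (pi0_incl G) = [set C; negC].
Proof.
move=> G G1 G1_K0 C negC.
pose F := ac_field (Qlbar l); pose Psi : 'M[F]_N := Psi_bar (Qlbar l) (ph_form H).
pose rb := rep_bar (Qlbar l) (rho l).
have rb_GIso g : GIso Psi (rb g) by exact: (rep_bar_GIso (Qlbar l) (rho_psi l)).
pose S : set 'M[F]_N := rb @` setT.
have gS : mxgroup S by exact: rep_bar_group.
have S_GIso : S `<=` GIso Psi by move=> _ [g _ <-].
have GE : G = GIso Psi `&` hull S by exact: Galg_hull.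
have gG : mxgroup G by rewrite GE; exact: mxgroup_closure.
have hom_G : homotheties F N `<=` G by exact: Galg_homotheties n_neq0 R2.
pose C0 := id_component G.
have gC0 : mxgroup C0 by exact: mxgroup_id_component.
have hom1 : homotheties F N 1%:M by exists 1 => //=; rewrite oner_neq0.
have hom_C0 : homotheties F N `<=` C0.
  by apply: id_component_max => //; exact: homotheties_connected.
have C0G : C0 `<=` G := @id_component_sub _ _ G.
have C0_GIso : C0 `<=` GIso Psi by move=> A /C0G [].
have two_neq0 : 2 != 0 :> F.
  rewrite -(rmorph_nat (ac_emb (Qlbar l) \o Qp_emb (Ql l))) fmorph_eq0.
  by rewrite pnatr_eq0.
have Psi_neq0 : (0 < N)%N -> Psi != 0 by exact: Psi_bar_neq0.
have K0P g : gal_over j g <-> C0 (rb g) by rewrite -K0E.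
(* By [K0E] the image of [G_K0] is [S :&: C0], and representatives of the finitely many cosets of
   [G_K0] serve in [id_component_closure]. *)
have GK0 : Galg (Qlbar l) (ph_form H) (rho l) (gal_over j) = C0.
  rewrite Galg_hull.
  have -> : rep_bar (Qlbar l) (rho l) @` gal_over j = S `&` C0.
    apply/seteqP; split=> [_ [g /K0P Cg <-]|_ [[g _ <-] /K0P jg]]; last by exists g.
    by split=> //; exists g.
  have [T [gs gsP]] := gal_over_finite_index jK.
  rewrite /C0 GE.
  apply: (@id_component_closure _ _ _ _ gS S_GIso T (rb \o gs)) => //.
    by move=> t /=; exists (gs t).
  move=> _ [g _ <-]; have [t [h [jh <-]]] := gsP g; exists t.
  have [_ [_ [ut _]]] := rep_barV (Qlbar l) (rho l) (gs t).
  by rewrite -GE /= /rb rep_barM mulKmx //; apply/K0P.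
have X_G1 : C0 `&` Iso Psi = G1 `&` C0.
  apply/seteqP; split=> [A [CA IA]|A [[_ IA] CA]]; split=> //.
  by split=> //; exact: C0G.
have gG1 : mxgroup G1.
  split.
  - split; first exact: (mxgroup1 gG).
    by apply/IsoP; have := multiplier_scalar Psi (oner_neq0 F); rewrite expr1n.
  - move=> A B [GA /IsoP IA] [GB /IsoP IB]; split; first exact: (mxgroupM gG).
    by apply/IsoP; have := multiplierM IA IB; rewrite mulr1.
  - move=> A [GA /IsoP IA]; have [uA GV] := mxgroupV gG GA; split=> //; split=> //.
    by apply/IsoP; have := multiplierV IA; rewrite invr1.
(* [C] is connected and contains [1], so it already lies in [C0]; thus passing from [G1] to
   [C0 :&: Iso] keeps the identity component. *)
have idX : id_component (C0 `&` Iso Psi) = C.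
  apply/seteqP; split.
    apply: (@connected_component_max (zariski F N)) => [||].
    - rewrite X_G1; apply: (@connected_component_refl (zariski F N)).
      by split; [exact: (mxgroup1 gG1)|exact: (mxgroup1 gC0)].
    - by move=> A /(@connected_component_sub (zariski F N)); rewrite X_G1 => -[].
    - exact: (@component_connected (zariski F N)).
  have C_C0 : C `<=` C0.
    apply: id_component_max; first exact: id_component1.
      by move=> A /(@connected_component_sub (zariski F N)) [].
    exact: id_component_connected.
  apply: (@connected_component_max (zariski F N)) => [||].
  - exact: id_component1.
  - move=> A CA; rewrite X_G1; split; [exact: id_component_sub CA|exact: C_C0].
  - exact: id_component_connected.
have XE : C0 `&` Iso Psi = C `|` negC.
  rewrite /negC -idX; apply: isometries_two_components => //.
  exact: id_component_connected.
split; first by rewrite /G1_K0 /Galg1 GK0.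
have G1G : G1 `<=` G by move=> A [].
have opp1 : G1 (- 1%:M).
  have N1 : -1 != 0 :> F by rewrite oppr_eq0 oner_neq0.
  rewrite -[- 1%:M]raddfN /=; split; first by apply: hom_G; exists (-1).
  by apply/IsoP; have := multiplier_scalar Psi N1; rewrite sqrrN expr1n.
(* An element of [G] differs from an isometry by a homothety, and homotheties lie in [C0]. *)
have cosets A : G A -> exists2 B, G1 B & C0 (invmx A *m B).
  move=> GA; have [uA _] := mxgroupV gG GA.
  have [t [B [t0 IB DA]]] := GIso_root GA.1.
  have Vt0 : t^-1 != 0 by rewrite invr_eq0.
  have DB : B = t^-1%:M *m A by rewrite DA mul_scalar_mx scalerA mulVf // scale1r.
  exists B; last first.
    rewrite DB mul_scalar_mx -scalemxAr mulVmx // scalemx1.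
    by apply: hom_C0; exists t^-1.
  split=> //; rewrite DB; apply: (mxgroupM gG) => //.
  by apply: hom_G; exists t^-1.
have G1C : G1 `&` C0 = C `|` negC by rewrite -X_G1.
by split; [exact: pi0_incl_epi|exact: pi0_incl_ker].
Qed.
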